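(* Let $n\in\{2,3\}$, let $\Omega\subset\mathbf{R}^n$ be a bounded domain with smooth boundary and unit outward normal $\nu$, and let $T>0$. Let $\gamma_0$ be a smooth positive function on $\overline\Omega$, and let $\gamma=(\gamma_{ij})$ and an open set $D$ satisfy the standing assumptions listed in the context (in particular one of (A1), (A2)). Assume that there exist real constants $C_1$ and $\mu_1$ such that the functions $F(\cdot,\tau)\in L^2(\Omega)$ satisfy, as $\tau\to\infty$, $$\Vert F(\cdot,\tau)\Vert_{L^2(\Omega)}=O(e^{C_1\tau}\tau^{\mu_1}).$$ Assume that $(v_\tau)_{\tau\ge\tau_0}$, for some $\tau_0>0$, is a family of (complex-valued) solutions in $H^1(\Omega)$ of $$\nabla\cdot\gamma_0\nabla v-\tau v=0\quad\text{in }\Omega$$ such that, for some real constants $\mu_2,\mu_3,\mu_4,C_2,C_3$ and some constant $C''>0$, as $\tau\to\infty$, $$\Vert\nabla v_\tau\Vert_{L^2(D)}=O(e^{C_2\tau}\tau^{\mu_2}),\qquad \Vert\nabla v_\tau\Vert_{L^2(D)}\ge C''e^{C_2\tau}\tau^{\mu_3}\ \text{ (for all sufficiently large }\tau),\qquad \Vert v_\tau\Vert_{H^1(\Omega)}=O(e^{C_3\tau}\tau^{\mu_4}).$$ Let $g=g(x,\tau)$, $x\in\partial\Omega$, have the form $$g=\Psi(\tau)\,\gamma_0\frac{\partial v_\tau}{\partial\nu}\Big|_{\partial\Omega},$$ where $\Psi$ satisfies, for some real constants $\mu$ and $\mu'$, $$\liminf_{\tau\to\infty}\tau^{\mu}|\Psi(\tau)|>0\qquad\text{and}\qquad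 |\Psi(\tau)|=O(\tau^{\mu'})\ \text{ as }\tau\to\infty.$$ Let $w=w(\cdot,\tau)$ be the (weak) solution of $$(\nabla\cdot\gamma\nabla-\tau)w=e^{-\tau T}F(x,\tau)\ \text{ in }\Omega,\qquad \gamma\nabla w\cdot\nu=g(x,\tau)\ \text{ on }\partial\Omega.$$ If $T$ satisfies $$T>C_1+C_3-2C_2,$$ then $$\lim_{\tau\to\infty}\frac{1}{2\tau}\log\left|\int_{\partial\Omega}\left(g\,\overline{v_\tau}-w\,\gamma_0\frac{\partial\overline{v_\tau}}{\partial\nu}\right)dS\right|=C_2.$$
   Context: Standing assumptions on $\gamma$, $\gamma_0$, $D$: $\gamma(x)=(\gamma_{ij}(x))$ is a real symmetric $n\times n$ matrix with entries in $L^\infty(\Omega)$, and there is a constant $C>0$ with $\gamma(x)\xi\cdot\xi\ge C|\xi|^2$ for all $\xi\in\mathbf{R}^n$ and a.e. $x\in\Omega$. $D$ is an open set with smooth boundary and $\overline D\subset\Omega$; $\gamma(x)=\gamma_0(x)I_n$ for a.e. $x\in\Omega\setminus D$, where $\gamma_0$ is a smooth positive function on $\overline\Omega$. Moreover one of the following holds for some constant $C'>0$: (A1) $-(\gamma(x)-\gamma_0(x)I_n)\xi\cdot\xi\ge C'|\xi|^2$ for all $\xi\in\mathbf{R}^n$ and a.e. $x\in D$; (A2) $(\gamma(x)-\gamma_0(x)I_n)\xi\cdot\xi\ge C'|\xi|^2$ for all $\xi\in\mathbf{R}^n$ and a.e. $x\in D$. Solutions of the elliptic equations are $H^1(\Omega)$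 weak solutions; conormal derivatives on $\partial\Omega$ are understood in $H^{-1/2}(\partial\Omega)$ and the boundary integrals as the corresponding (bilinear) duality pairings with traces in $H^{1/2}(\partial\Omega)$. *)

(* Defs.v *)
From HB Require Import structures.
From mathcomp Require Import all_boot all_order all_algebra.
From mathcomp Require Import complex.
From mathcomp Require Import all_classical all_reals all_analysis.
From mathcomp Require Import measurable_realfun.

Set Implicit Arguments.
Unset Strict Implicit.
Unset Printing Implicit Defensive.

Import Order.TTheory GRing.Theory Num.Theory.
Import numFieldNormedType.Exports.
Import ComplexField.Normc.

Local Open Scope classical_set_scope.
Local Open Scope ring_scope.

Definition borel_display : measure_display.
Proof. exact: default_measure_display. Qed.

Section borel_rV.
Context (R : realType) (n : nat).

Definition borel_rV : set (set 'rV[R]_n) := <<s [set A | open A] >>.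

Let borel0 : borel_rV set0.
Proof. exact: sigma_algebra0. Qed.
Let borelC A : borel_rV A -> borel_rV (~` A).
Proof. exact: sigma_algebraC. Qed.
Let borel_bigcup (F : (set 'rV[R]_n)^nat) :
  (forall i, borel_rV (F i)) -> borel_rV (\bigcup_i (F i)).
Proof. exact: sigma_algebra_bigcup. Qed.

HB.instance Definition _ := @isMeasurable.Build borel_display 'rV[R]_n
  borel_rV borel0 borelC borel_bigcup.
End borel_rV.

Lemma open_rV_bigcup (R : realType) n (A : set 'rV[R]_n) : open A ->
  A = \bigcup_(q in [set q : 'rV[rat]_n * nat |
        ball (map_mx ratr q.1 : 'rV[R]_n) q.2.+1%:R^-1 `<=` A])
      ball (map_mx ratr q.1 : 'rV[R]_n) q.2.+1%:R^-1.
Proof.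
move=> oA; apply/seteqP; split => [x Ax|x [q /= + xq]]; last exact.
have [e /= e0 xeA] : nbhs_ball x A by apply/nbhs_ballP; exact: open_nbhs_nbhs.
have [m _ me] : \forall m \near \oo, m.+1%:R^-1 < e / 2.
  by near=> m; near: m; apply: near_infty_natSinv_lt (PosNum (divr_gt0 e0 (ltr0Sn _ 1))).
have {me} me := me m (leqnn m).
have m0 : 0 < m.+1%:R^-1 :> R by rewrite invr_gt0.
have /choice[f fP] : forall j : 'I_n, exists q : rat,
    ball (ratr q : R) m.+1%:R^-1 (x ord0 j).
  move=> j; have : x ord0 j - m.+1%:R^-1 < x ord0 j + m.+1%:R^-1.
    by rewrite ltrD2l gtrN.
  move=> /rat_in_itvoo[q]; rewrite in_itv/= => /andP[q1 q2]; exists q.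
  by rewrite /ball/= ltr_distlC ltrBlDr q2/= -ltrBlDr.
exists (\row_j f j, m) => /=; last first.
  by split => // i j; rewrite !mxE (ord1 i); exact: fP.
move=> y [_ qy]; apply: xeA; split=> // i j; rewrite (ord1 i).
rewrite [e]splitr; apply: (@ball_triangle _ _ (ratr (f j) : R)).
  by apply: ball_sym; apply: le_ball (fP j); exact: ltW.
by have := qy ord0 j; rewrite !mxE; apply: le_ball; exact: ltW.
Unshelve. all: by end_near. Qed.

(* Lebesgue measure on R^n, by iterating the product with the one-dimensional
   Lebesgue measure of the library; the result is carried by row vectors along
   the bijection rV_cons : R * R^n -> R^(n+1). *)
Section lebesgue_rV.
Context (R : realType).
Local Notation M n := {sigma_finite_measure set 'rV[R]_n -> \bar R}.

Let leb1 : {sigma_finite_measure set (measurableTypeR R) -> \bar R} :=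
  lebesgue_measure.

Section step.
Context (n : nat) (m : M n).

Definition rV_cons (x : measurableTypeR R * 'rV[R]_n) : 'rV[R]_n.+1 :=
  \row_j oapp (x.2 ord0) x.1 (unlift ord0 j).

Lemma measurable_rV_cons : measurable_fun [set: measurableTypeR R * 'rV[R]_n] rV_cons.
Proof.
apply: (measurability [set A : set 'rV[R]_n.+1 | open A]) => //.
move=> _ [A oA <-]; rewrite setTI (open_rV_bigcup oA) preimage_bigcup.
rewrite bigcup_mkcond; apply: countable_bigcupT_measurable; first exact: countableP.
move=> -[q k]; case: ifPn => // _.
set c := map_mx _ _ : 'rV[R]_n.+1.
pose c0 := c ord0 ord0.
pose c1 : 'rV[R]_n := \row_k c ord0 (lift ord0 k).
rewrite (_ : _ @^-1` _ = ball c0 k.+1%:R^-1 `*` ball c1 k.+1%:R^-1); last first.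
  apply/seteqP; split => [[a y] /= [_ cy]|[a y] /= [ca [_ cy]]].
    split; [|split=> // i j].
    - by have := cy ord0 ord0; rewrite [rV_cons _ _ _]mxE unlift_none.
    - by have := cy ord0 (lift ord0 j); rewrite [rV_cons _ _ _]mxE liftK (ord1 i) [c1 _ _]mxE.
  split=> // i j; rewrite (ord1 i) [rV_cons _ _ _]mxE; case: unliftP => [k' ->|->]//=.
  by have := cy ord0 k'; rewrite [c1 _ _]mxE.
apply: measurableX; first by apply: open_measurable; exact: ball_open.
by apply: sub_sigma_algebra; exact: ball_open.
Qed.

Definition lebesgue_cons : set 'rV[R]_n.+1 -> \bar R :=
  pushforward (leb1 \x m)%E rV_cons.

Let lebesgue_cons0 : lebesgue_cons set0 = 0.
Proof. by rewrite /lebesgue_cons /pushforward preimage_set0 measure0. Qed.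

Let lebesgue_cons_ge0 A : (0 <= lebesgue_cons A)%E.
Proof. by rewrite /lebesgue_cons /pushforward; exact: measure_ge0. Qed.

Let lebesgue_cons_sigma_additive : semi_sigma_additive lebesgue_cons.
Proof.
move=> F mF tF mUF; rewrite /lebesgue_cons /pushforward preimage_bigcup.
apply: measure_semi_sigma_additive.
- by move=> k; rewrite -[X in measurable X]setTI; exact: measurable_rV_cons.
- apply/trivIsetP => /= i j _ _ ij; rewrite -preimage_setI.
  by move/trivIsetP : tF => /(_ _ _ _ _ ij) ->//; rewrite preimage_set0.
- by rewrite -preimage_bigcup -[X in measurable X]setTI; exact: measurable_rV_cons.
Qed.

HB.instance Definition _ := isMeasure.Build _ _ _ lebesgue_cons
  lebesgue_cons0 lebesgue_cons_ge0 lebesgue_cons_sigma_additive.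

Let rV_uncons (x : 'rV[R]_n.+1) : measurableTypeR R * 'rV[R]_n :=
  (x ord0 ord0, \row_k x ord0 (lift ord0 k)).

Let rV_consK : cancel rV_cons rV_uncons.
Proof.
case=> a y; rewrite /rV_uncons /= mxE unlift_none/=; congr pair.
by apply/rowP => k; rewrite !mxE liftK.
Qed.

Let measurable_rV_uncons : measurable_fun [set: 'rV[R]_n.+1] rV_uncons.
Proof.
apply/measurable_fun_pairP; split.
- apply: (measurability _ (RGenOInfty.measurableE R)).
  move=> _ [_ [a ->] <-]; rewrite setTI; apply: sub_sigma_algebra => /=.
  have: open `]a, +oo[%classic by exact: interval_open.
  by apply: open_comp => x _; exact: coord_continuous.
- apply: (measurability [set A : set 'rV[R]_n | open A]) => //.
  move=> _ [A oA <-]; rewrite setTI; apply: sub_sigma_algebra => /=.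
  apply: open_comp oA => x _ B /nbhs_ballP[e /= e0 eB].
  apply/nbhs_ballP; exists e => // y [_ xy]; apply: eB; split=> // i j.
  by rewrite !mxE; exact: xy.
Qed.

Let lebesgue_cons_sigma_finite : sigma_finite setT lebesgue_cons.
Proof.
have /sigma_finiteP[F [TF ndF Foo]] := sigma_finiteT leb1.
have /sigma_finiteP[G [TG ndG Goo]] := sigma_finiteT m.
exists (fun k => rV_uncons @^-1` (F k `*` G k)).
  rewrite -preimage_bigcup (_ : \bigcup_k (F k `*` G k) = setT) ?preimage_setT//.
  rewrite -setXTT TF TG predeqE => -[x y]; split.
    by move=> [k _ []/= ? ?]; split; exists k.
  move=> [/= [k _ Fkx] [l _ Gly]]; exists (maxn k l) => //; split.
  - by move: x Fkx; exact/subsetPset/ndF/leq_maxl.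
  - by move: y Gly; exact/subsetPset/ndG/leq_maxr.
move=> k; have [mF Fk] := Foo k; have [mG Gk] := Goo k; split.
  by rewrite -[X in measurable X]setTI; apply: measurable_rV_uncons => //;
    exact: measurableX.
rewrite /lebesgue_cons /pushforward -comp_preimage.
rewrite (_ : rV_uncons \o rV_cons = id); last exact/funext/rV_consK.
rewrite [X in (X < _)%E](product_measure1E leb1 m mF mG).
by rewrite lte_mul_pinfty// ge0_fin_numE.
Qed.

HB.instance Definition _ := Measure_isSigmaFinite.Build _ _ _ lebesgue_cons
  lebesgue_cons_sigma_finite.
End step.

Fixpoint lebesgue_rV n : M n :=
  if n is k.+1 then lebesgue_cons (lebesgue_rV k) else \d_ (0 : 'rV[R]_0).
End lebesgue_rV.


Section euclidean.
Context (R : realType) (n : nat).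
Implicit Types (x y : 'rV[R]_n) (A : set 'rV[R]_n).

(* The library norm `|x| on row vectors is the sup norm. *)
Definition enorm x : R := Num.sqrt (\sum_i x ord0 i ^+ 2).

Definition ediam A : \bar R :=
  ereal_sup [set (enorm (xy.1 - xy.2))%:E | xy in A `*` A].

Definition boundary A : set 'rV[R]_n := closure A `\` A°.

End euclidean.

(* Volume of the unit ball of R^d: omega_(d+2) = 2 pi / (d + 2) omega_d. *)
Fixpoint ball_volume (R : realType) (d : nat) : R :=
  match d with
  | 0 => 1
  | 1 => 2
  | k.+2 => 2 * pi / k.+2%:R * ball_volume R k
  end.

Section hausdorff.
Context (R : realType) (n : nat).
Local Open Scope ereal_scope.

Definition hausdorff_weight (d : nat) (delta : R) (A : set 'rV[R]_n) : \bar R :=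
  if `[< A = set0 >] then 0
  else if ediam A <= delta%:E
  then (ball_volume R d * (fine (ediam A) / 2) ^+ d)%R%:E
  else +oo.

(* mu_ext takes the infimum over countable covers by Borel sets; since a set and
   its closure have the same diameter, this is the infimum over all covers. *)
Definition hausdorff_content (d : nat) (delta : R) : set 'rV[R]_n -> \bar R :=
  mu_ext (hausdorff_weight d delta).

(* d-dimensional Hausdorff measure, normalised so as to agree with the surface
   measure on smooth d-dimensional submanifolds. *)
Definition hausdorff (d : nat) (A : set 'rV[R]_n) : \bar R :=
  ereal_sup [set hausdorff_content d delta A | delta in [set e : R | (0 < e)%R]].

Lemma ball_volume_ge0 d : (0 <= ball_volume R d)%R.
Proof.
suff : (0 <= ball_volume R d)%R /\ (0 <= ball_volume R d.+1)%R by case.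
elim: d => [|d [ih1 ih2]]; first by split.
by split=> //=; rewrite mulr_ge0// divr_ge0// mulr_ge0// pi_ge0.
Qed.

Let weight0 d delta : hausdorff_weight d delta set0 = 0.
Proof. by rewrite /hausdorff_weight asboolT. Qed.

Let weight_ge0 d delta A : 0 <= hausdorff_weight d delta A.
Proof.
rewrite /hausdorff_weight; case: asboolP => // /eqP/set0P[x Ax].
case: ifPn => // _; rewrite lee_fin mulr_ge0 ?ball_volume_ge0// exprn_ge0//.
rewrite divr_ge0// fine_ge0//; apply: ereal_sup_ubound.
exists (x, x) => //=; rewrite subrr /enorm big1 ?sqrtr0// => i _.
by rewrite mxE expr0n.
Qed.

Let hausdorff_ge_content d delta A : (0 < delta)%R ->
  hausdorff_content d delta A <= hausdorff d A.
Proof. by move=> delta0; apply: ereal_sup_ubound; exists delta. Qed.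

Let hausdorff_ge0 d A : 0 <= hausdorff d A.
Proof. exact: le_trans (mu_ext_ge0 (weight_ge0 d 1) A) (hausdorff_ge_content _ _ _). Qed.

Let hausdorff0 d : hausdorff d set0 = 0.
Proof.
apply/eqP; rewrite eq_le hausdorff_ge0 andbT; apply: ge_ereal_sup => _ [e _ <-].
by rewrite /hausdorff_content mu_ext0.
Qed.

Let le_hausdorff d : {homo hausdorff d : A B / A `<=` B >-> A <= B}.
Proof.
move=> A B AB; apply: ge_ereal_sup => _ [e /= e0 <-].
exact: le_trans (le_mu_ext _ AB) (hausdorff_ge_content _ _ e0).
Qed.

Let hausdorff_sigma_subadditive d : sigma_subadditive (hausdorff d).
Proof.
move=> F; apply: ge_ereal_sup => _ [e /= e0 <-].
apply: le_trans (mu_ext_sigma_subadditive (weight_ge0 d e) F) _.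
apply: lee_nneseries => [k _ _|k _]; first exact: mu_ext_ge0.
exact: hausdorff_ge_content.
Qed.

HB.instance Definition _ d := isOuterMeasure.Build R 'rV[R]_n (hausdorff d)
  (hausdorff0 d) (hausdorff_ge0 d) (@le_hausdorff d)
  (@hausdorff_sigma_subadditive d).

End hausdorff.

(* Surface measure dS on hypersurfaces of R^n: (n-1)-dimensional Hausdorff
   measure on its Caratheodory-measurable sets. *)
Section surface.
Context (R : realType) (n : nat).

Let hausdorff_surface : {outer_measure set 'rV[R]_n -> \bar R} :=
  @hausdorff R n n.-1.

Definition surface :
    {measure set (caratheodory_type hausdorff_surface) -> \bar R} :=
  hausdorff_surface.

End surface.

Section complex_L2.
Context d (T : measurableType d) (R : realType) (mu : {measure set T -> \bar R}).
Implicit Types (D : set T) (f : T -> R[i]).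

Definition cmeasurable_fun D f :=
  measurable_fun D (fun x => complex.Re (f x)) /\
  measurable_fun D (fun x => complex.Im (f x)).

Definition cintegral D f : R[i] :=
  ((\int[mu]_(x in D) complex.Re (f x)) +i*
   (\int[mu]_(x in D) complex.Im (f x)))%C.

Definition sqr_integral D f : \bar R :=
  (\int[mu]_(x in D) ((normc (f x)) ^+ 2)%:E)%E.

Definition inL2 D f := cmeasurable_fun D f /\ (sqr_integral D f < +oo)%E.

Definition L2norm D f : R := Num.sqrt (fine (sqr_integral D f)).

Definition cvgL2 D (f_ : nat -> T -> R[i]) f :=
  [/\ forall k, inL2 D (f_ k), inL2 D f
    & L2norm D (fun x => f_ k x - f x) @[k --> \oo] --> (0 : R)].

End complex_L2.

Section smooth_functions.
Context (R : realType) (n : nat).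
Implicit Types (U A : set 'rV[R]_n) (f : 'rV[R]_n -> R).

Definition partial (i : 'I_n) f : 'rV[R]_n -> R :=
  fun x => 'D_(delta_mx ord0 i) f x.

(* Meaningful for U open. *)
Fixpoint Ck (k : nat) U f : Prop :=
  (forall x, U x -> {for x, continuous f}) /\
  if k is l.+1 then
    forall i, (forall x, U x -> derivable f x (delta_mx ord0 i)) /\
              Ck l U (partial i f)
  else True.

Definition smooth_on U f := forall k, Ck k U f.

(* Restriction to A of a smooth function on R^n. *)
Definition smooth_up_to A f :=
  exists2 g, smooth_on setT g & forall x, A x -> f x = g x.

(* Near each of its boundary points, A is the sublevel set {rho < 0} of a smooth
   function rho without critical points. *)
Definition smooth_boundary A := forall x0, boundary A x0 ->
  exists U : set 'rV[R]_n, exists rho : 'rV[R]_n -> R,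
    [/\ open U /\ U x0, smooth_on U rho,
        forall x, U x -> exists i, partial i rho x <> 0
      & forall x, U x -> (A x <-> rho x < 0)].

Definition bounded_smooth_domain A :=
  [/\ open A, connected A, A !=set0, bounded_set A & smooth_boundary A].

Definition test_function A f := smooth_on setT f /\
  exists K, [/\ compact K, K `<=` A & forall x, ~ K x -> f x = 0].

Definition csmooth (f : 'rV[R]_n -> R[i]) :=
  smooth_on setT (fun x => complex.Re (f x)) /\
  smooth_on setT (fun x => complex.Im (f x)).

Definition cpartial (i : 'I_n) (f : 'rV[R]_n -> R[i]) : 'rV[R]_n -> R[i] :=
  fun x => (partial i (fun y => complex.Re (f y)) x +i*
            partial i (fun y => complex.Im (f y)) x)%C.

End smooth_functions.

Section sobolev.
Context (R : realType) (n : nat).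
Local Notation leb := (@lebesgue_rV R n).
Local Notation dS := (@surface R n).
Implicit Types (Omega D : set 'rV[R]_n).
Implicit Types (u f h : 'rV[R]_n -> R[i]).
Implicit Types (G : 'I_n -> 'rV[R]_n -> R[i]).
Implicit Types (A : 'rV[R]_n -> 'M[R]_n).

(* u belongs to H^1(Omega) and G i is (a representative of) its weak
   derivative in the direction i. *)
Definition inH1 Omega u G :=
  [/\ inL2 leb Omega u, forall i, inL2 leb Omega (G i)
    & forall i phi, test_function Omega phi ->
        cintegral leb Omega (fun x => u x * (partial i phi x)%:C%C) =
        - cintegral leb Omega (fun x => G i x * (phi x)%:C%C)].

Definition gradnorm D G : R := Num.sqrt (\sum_i L2norm leb D (G i) ^+ 2).

Definition H1norm Omega u G : R :=
  Num.sqrt (L2norm leb Omega u ^+ 2 + gradnorm Omega G ^+ 2).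

(* The bilinear expression (A G) . H, without complex conjugation. *)
Definition flux_dot A G (H : 'I_n -> 'rV[R]_n -> R[i]) (x : 'rV[R]_n) : R[i] :=
  \sum_i \sum_j (A x i j)%:C%C * G j x * H i x.

(* div (A grad u) = f in Omega in the weak sense, where G = grad u. *)
Definition weak_div Omega A G f := forall phi, test_function Omega phi ->
  cintegral leb Omega
    (flux_dot A G (fun i x => (partial i phi x)%:C%C)) =
  - cintegral leb Omega (fun x => f x * (phi x)%:C%C).

(* h is the trace on the boundary of u in H^1(Omega): u is the limit in
   H^1(Omega) of functions smooth up to the boundary, whose restrictions to the
   boundary converge to h in L^2(dS). *)
Definition is_trace Omega u G h := exists phi : nat -> 'rV[R]_n -> R[i],
  [/\ forall k, csmooth (phi k), cvgL2 leb Omega phi u,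
      forall i, cvgL2 leb Omega (fun k => cpartial i (phi k)) (G i)
    & cvgL2 dS (boundary Omega) phi h].

(* Squared Slobodeckij seminorm of order 1/2 on the (n-1)-dimensional boundary:
   the exponent of the kernel is (n - 1) + 2 * (1 / 2) = n. *)
Definition half_seminorm2 Omega h : \bar R :=
  (\int[dS]_(x in boundary Omega) \int[dS]_(y in boundary Omega)
     (normc (h x - h y) ^+ 2 / enorm (x - y : 'rV[R]_n) ^+ n)%R%:E)%E.

Definition inHhalf Omega h :=
  inL2 dS (boundary Omega) h /\ (half_seminorm2 Omega h < +oo)%E.

Definition Hhalf_norm Omega h : R :=
  Num.sqrt (L2norm dS (boundary Omega) h ^+ 2 + fine (half_seminorm2 Omega h)).

(* Bounded linear functionals on H^{1/2}; l h is the bilinear duality pairing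
   of l with h, and is irrelevant for h outside H^{1/2}. *)
Definition inHmhalf Omega (l : ('rV[R]_n -> R[i]) -> R[i]) :=
  (forall (a : R[i]) h k, inHhalf Omega h -> inHhalf Omega k ->
     l (fun x => a * h x + k x) = a * l h + l k) /\
  (exists M : R, forall h, inHhalf Omega h ->
     normc (l h) <= M * Hhalf_norm Omega h).

(* l is the conormal derivative (A grad u) . nu on the boundary, where G = grad u
   and div (A grad u) = f in Omega, defined as usual through Green's formula. *)
Definition is_conormal Omega A G f (l : ('rV[R]_n -> R[i]) -> R[i]) :=
  inHmhalf Omega l /\
  forall phi Gphi h, inH1 Omega phi Gphi -> is_trace Omega phi Gphi h ->
    l h = cintegral leb Omega (fun x => flux_dot A G Gphi x + f x * phi x).

End sobolev.

Section conductivity.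
Context (R : realType) (n : nat).
Local Notation leb := (@lebesgue_rV R n).
Implicit Types (Omega D : set 'rV[R]_n).

Definition quad (M : 'M[R]_n) (xi : 'cV[R]_n) : R :=
  \sum_i (M *m xi) i ord0 * xi i ord0.

Definition sqrnorm (xi : 'cV[R]_n) : R := \sum_i xi i ord0 ^+ 2.

Definition inLinfty Omega (f : 'rV[R]_n -> R) := measurable_fun Omega f /\
  exists M : R, {ae leb, forall x, Omega x -> `|f x| <= M}.

Definition condA1 D (gamma : 'rV[R]_n -> 'M[R]_n) (gamma0 : 'rV[R]_n -> R) :=
  exists2 C' : R, 0 < C' &
  {ae leb, forall x, D x -> forall xi,
     - quad (gamma x - (gamma0 x)%:M) xi >= C' * sqrnorm xi}.

Definition condA2 D (gamma : 'rV[R]_n -> 'M[R]_n) (gamma0 : 'rV[R]_n -> R) :=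
  exists2 C' : R, 0 < C' &
  {ae leb, forall x, D x -> forall xi,
     quad (gamma x - (gamma0 x)%:M) xi >= C' * sqrnorm xi}.

Record standing_assumptions Omega D
    (gamma : 'rV[R]_n -> 'M[R]_n) (gamma0 : 'rV[R]_n -> R) : Prop := {
  gamma_Linfty : forall i j, inLinfty Omega (fun x => gamma x i j);
  gamma_sym : {ae leb, forall x, Omega x -> (gamma x)^T = gamma x};
  gamma_elliptic : exists2 C : R, 0 < C &
    {ae leb, forall x, Omega x -> forall xi, quad (gamma x) xi >= C * sqrnorm xi};
  D_open : open D;
  D_smooth : smooth_boundary D;
  D_inside : closure D `<=` Omega;
  gamma0_smooth : smooth_up_to (closure Omega) gamma0;
  gamma0_pos : forall x, closure Omega x -> 0 < gamma0 x;
  gamma_outside : {ae leb, forall x, (Omega `\` D) x -> gamma x = (gamma0 x)%:M};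
  gamma_jump : condA1 D gamma gamma0 \/ condA2 D gamma gamma0
}.

End conductivity.

(* f(tau) = O(g(tau)) as tau -> +oo. *)
Definition bigO_pinfty (R : realType) (f g : R -> R) :=
  exists K : R, \forall tau \near +oo_R, `|f tau| <= K * `|g tau|.

(* Main.v *)
(* Put u = Psi v. Green's formula gives, for phi = conj u and phi = conj w,
     int (gamma grad w . grad phi + (tau w + F') phi)
       = int (gamma0 grad u . grad phi + tau u phi),     F' = e^(-tau T) F,
   and J = conj Psi * (boundary integral) is the first left-hand side minus
   int (gamma0 grad w . grad (conj u) + tau w conj u). Adding multiples of the
   two identities to Re J completes the square, with eps = w - u: under (A1),
     - Re J = int gamma |grad eps|^2 + (gamma0 - gamma) |grad u|^2
                + tau |eps|^2 + Re F' conj (eps - u),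
   and under (A2),
     Re J = int gamma0 |grad eps|^2 + (gamma - gamma0) |grad w|^2
                + tau |eps|^2 + Re F' conj w.
   Both dominate |grad u|^2 over D up to terms in F'. Conversely the difference
   of the identities bounds grad eps by grad u over D, hence |J| from above,
   since gamma - gamma0 vanishes outside D. Pointwise AM-GM with a weight
   s = s(tau) replaces the Cauchy-Schwarz inequality, and the condition on T
   makes the terms in F' exponentially smaller than e^(2 C2 tau). *)

Require Import Defs.
From HB Require Import structures.
From mathcomp Require Import all_boot all_order all_algebra.
From mathcomp Require Import complex.
From mathcomp Require Import all_classical all_reals all_analysis.
From mathcomp Require Import measurable_realfun.
From mathcomp Require Import ring lra.

Import Order.TTheory GRing.Theory Num.Theory.
Import numFieldNormedType.Exports.
Import ComplexField.Normc.

Local Open Scope classical_set_scope.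
Local Open Scope ring_scope.

Set Implicit Arguments.
Unset Strict Implicit.
Unset Printing Implicit Defensive.

(** * Exponential rates *)

Section asymptotics.
Context (R : realType).
Implicit Types (a b c p q s e K : R) (I : R -> R).

(** Use [ln x < x] at [x = e / 2 * t]: one half of [e * t] bounds this logarithm, the other half
    pays for the constant [- ln (e / 2)]. *)
Lemma ln_le_linear e : 0 < e -> \forall t \near +oo_R, ln t <= e * t.
Proof.
move=> e0; have e20 : 0 < e / 2 by lra.
near=> t.
have t0 : 0 < t by near: t; exact: nbhs_pinfty_gt.
have : ln (e / 2 * t) < e / 2 * t by apply: ln_sublinear; rewrite mulr_gt0.
rewrite lnM ?posrE// => h.
suff : - ln (e / 2) <= e / 2 * t by lra.
by rewrite [leRHS]mulrC -ler_pdivrMr//; near: t; apply: nbhs_pinfty_ge; rewrite num_real.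
Unshelve. all: by end_near. Qed.

Lemma ln_mul_le_linear c e : 0 < e -> \forall t \near +oo_R, c * ln t <= e * t.
Proof.
move=> e0; near=> t.
have t1 : 1 <= t by near: t; exact: nbhs_pinfty_ge.
have lt0 : 0 <= ln t by rewrite ln_ge0.
have c0 : 0 < `|c| + 1 by rewrite ltr_wpDl.
have h : ln t <= e / (`|c| + 1) * t.
  by near: t; apply: ln_le_linear; rewrite divr_gt0.
have : c * ln t <= (`|c| + 1) * ln t.
  by rewrite ler_wpM2r//; have := ler_norm c; lra.
move/le_trans; apply; rewrite mulrC -ler_pdivlMr//.
by apply: le_trans h _; rewrite mulrAC.
Unshelve. all: by end_near. Qed.

(** A gap between exponential rates beats all powers. Once everything is an exponential, half of
    [(b - a) * t] absorbs [(p - q) * ln t] and the other half absorbs [- ln e]. *)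
Lemma expR_powR_negligible a b p q e : a < b -> 0 < e ->
  \forall t \near +oo_R,
    expR (a * t) * t `^ p <= e * (expR (b * t) * t `^ q).
Proof.
move=> ab e0; near=> t.
have t0 : 0 < t by near: t; exact: nbhs_pinfty_gt.
rewrite /powR gt_eqF// -!expRD -{1}(lnK e0) -expRD ler_expR.
have h1 : (p - q) * ln t <= (b - a) / 2 * t.
  by near: t; apply: ln_mul_le_linear; lra.
have h2 : - ln e <= (b - a) / 2 * t.
  rewrite [leRHS]mulrC -ler_pdivrMr; last by lra.
  by near: t; apply: nbhs_pinfty_ge; rewrite num_real.
by lra.
Unshelve. all: by end_near. Qed.

Lemma ln_rate_ge a c p I e : 0 < c -> 0 < e ->
  (\forall t \near +oo_R, c * (expR (a * t) * t `^ p) <= I t) ->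
  \forall t \near +oo_R, 0 < I t /\ (a - e) * t <= ln (I t).
Proof.
move=> c0 e0 hI; near=> t.
have t0 : 0 < t by near: t; exact: nbhs_pinfty_gt.
have h : 1 * (expR ((a - e) * t) * t `^ 0) <= I t.
  apply: le_trans (_ : c * (expR (a * t) * t `^ p) <= _); last by near: t.
  by rewrite mul1r; near: t; apply: expR_powR_negligible => //; lra.
rewrite powRr0 mulr1 mul1r in h.
have I0 : 0 < I t by apply: lt_le_trans h; exact: expR_gt0.
by split => //; rewrite -ler_expR lnK.
Unshelve. all: by end_near. Qed.

(** The premise [0 < I t] stays inside the filter because [ln] is 0 by default at nonpositive
    arguments, where the bound fails if [a + e < 0]. *)
Lemma ln_rate_le a K p I e : 0 < e ->
  (\forall t \near +oo_R, I t <= K * (expR (a * t) * t `^ p)) ->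
  \forall t \near +oo_R, 0 < I t -> ln (I t) <= (a + e) * t.
Proof.
move=> e0 hI; near=> t => I0.
have t0 : 0 < t by near: t; exact: nbhs_pinfty_gt.
rewrite -ler_expR lnK//.
have K0 : 0 < `|K| + 1 by rewrite ltr_wpDl.
apply: le_trans (_ : (`|K| + 1) * (expR (a * t) * t `^ p) <= _).
  apply: le_trans (_ : K * (expR (a * t) * t `^ p) <= _); first by near: t.
  rewrite ler_wpM2r ?mulr_ge0 ?expR_ge0 ?powR_ge0//.
  by have := ler_norm K; lra.
rewrite [leLHS]mulrC -ler_pdivlMr// [leRHS]mulrC.
rewrite -[expR ((a + e) * t)]mulr1 -[X in _ * (_ * X)](powRr0 t).
near: t; apply: expR_powR_negligible; first by lra.
by rewrite invr_gt0.
Unshelve. all: by end_near. Qed.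

(** A squeeze after taking logarithms: constants and powers of [t] cost at most [e * t] for each
    [e > 0]. The lower bound makes [I t] eventually positive, so that [lne] is finite and the limit
    reduces to a real one. *)
Lemma cvg_log_rate a c p K q I : 0 < c ->
  (\forall t \near +oo_R, c * (expR (2 * a * t) * t `^ p) <= I t) ->
  (\forall t \near +oo_R, I t <= K * (expR (2 * a * t) * t `^ q)) ->
  (((2 * t)^-1)%:E * lne (I t)%:E)%E @[t --> +oo_R] --> a%:E.
Proof.
move=> c0 hlo hup.
(* This instance supplies positivity of [I t]; the loss 1 is arbitrary. *)
have lo1 := ln_rate_ge c0 ltr01 hlo.
apply: cvg_EFin.
  near=> t; have [I0 _] : 0 < I t /\ (2 * a - 1) * t <= ln (I t) by near: t.
  by rewrite lne_EFin// -EFinM.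
apply/cvgrPdist_le => e e0; near=> t.
have t0 : 0 < t by near: t; exact: nbhs_pinfty_gt.
have [I0 lo] : 0 < I t /\ (2 * a - e) * t <= ln (I t).
  by near: t; exact: ln_rate_ge hlo.
have up : 0 < I t -> ln (I t) <= (2 * a + e) * t.
  by near: t; exact: ln_rate_le hup.
have {}up := up I0.
rewrite [(fine \o _) t]/comp lne_EFin//= mulrC distrC ler_distl.
rewrite ler_pdivlMr ?ler_pdivrMr ?mulr_gt0//.
apply/andP; split; [apply: le_trans lo|apply: le_trans up _]; nra.
Unshelve. all: by end_near. Qed.

End asymptotics.

(** * From two-sided bounds on the indicator to its exponential rate *)

Section rate_of_indicator.
Context (R : realType).
Implicit Types (a b c p q s e K t : R).
Local Notation E a p t := (expR (a * t) * t `^ p).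

Lemma expR_powRM a b p q t : 0 < t ->
  E a p t * E b q t = E (a + b) (p + q) t.
Proof.
by move=> t0; rewrite /powR gt_eqF// -!expRD; congr expR; ring.
Qed.

Lemma expR_powR_ge0 a p t : 0 <= E a p t.
Proof. by rewrite mulr_ge0 ?expR_ge0 ?powR_ge0. Qed.

Lemma bigO_pinfty_le (f g : R -> R) : bigO_pinfty f g ->
  exists2 K, 0 < K & \forall t \near +oo_R, f t <= K * `|g t|.
Proof.
move=> [K hK]; exists (`|K| + 1); first by rewrite ltr_wpDl.
near=> t.
apply: (le_trans (ler_norm _)); apply: (@le_trans _ _ (K * `|g t|)); first by near: t.
by rewrite ler_wpM2r//; have := ler_norm K; lra.
Unshelve. all: by end_near. Qed.

(** The lower limit is a supremum of infima over neighbourhoods; if it is positive, so is one of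
    these infima. *)
Lemma limf_einf_gt0 (f : R -> R) :
  (0 < limf_einf (fun t => (f t)%:E) +oo_R)%E ->
  exists2 c, 0 < c & \forall t \near +oo_R, c <= f t.
Proof.
rewrite limf_einfE => /ereal_sup_gt[_ [V hV <-]] i0.
have [c /andP[c0 cV]] : exists c, (0 < c) && (c%:E <= ereal_inf [set (f x)%:E | x in V])%E.
  (* The infimum is a positive real, which serves as [c], or [+oo], and then 1 serves. *)
  move: i0; case: (ereal_inf _) => [r| |]//; rewrite ?lte_fin => r0.
    by exists r; rewrite r0/=.
  by exists 1; rewrite ltr01 leey.
exists c => //; apply: filterS hV => t Vt; rewrite -lee_fin.
by apply: le_trans cV _; apply: ereal_inf_lbound; exists t.
Qed.

(** If [b < a], the upper bound would eventually fall below half of the lower bound. *)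
Lemma exponent_le c a b p q K (f : R -> R) : 0 < c -> 0 < K ->
  (\forall t \near +oo_R, c * E a p t <= f t) ->
  (\forall t \near +oo_R, f t <= K * E b q t) -> a <= b.
Proof.
move=> c0 K0 lo up; rewrite leNgt; apply/negP => ba.
suff : \forall t \near +oo_R, False by move/filter_ex => -[].
near=> t.
have t0 : 0 < t by near: t; exact: nbhs_pinfty_gt.
have h1 : c * E a p t <= f t by near: t.
have h2 : f t <= K * E b q t by near: t.
have h3 : E b q t <= c / (2 * K) * E a p t.
  by near: t; apply: expR_powR_negligible => //; rewrite divr_gt0// mulr_gt0.
have : K * E b q t <= c / 2 * E a p t.
  apply: le_trans (_ : K * (c / (2 * K) * E a p t) <= _); first by rewrite ler_pM2l.
  rewrite le_eqVlt; apply/orP; left; apply/eqP; field; exact: lt0r_neq0.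
have : 0 < c / 2 * E a p t.
  by rewrite !mulr_gt0 ?expR_gt0 ?powR_gt0// invr_gt0.
by nra.
Unshelve. all: by end_near. Qed.

(** The PDE is reduced to scalar functions of the frequency: [A] will be the norm of grad v on D,
    [H] the H^1 norm of v, [Fn] the L^2 norm of F, [psi] the modulus of Psi, and [I] the modulus of
    the boundary integral. *)
Context (T C1 mu1 mu2 mu3 mu4 C2 C3 C'' mu mu' kappa K0 : R).
Context (A H Fn psi I : R -> R).
Hypotheses (C''0 : 0 < C'') (kappa0 : 0 < kappa) (K0_gt0 : 0 < K0).
Hypotheses (A_ge0 : forall t, 0 <= A t) (H_ge0 : forall t, 0 <= H t).
Hypotheses (Fn_ge0 : forall t, 0 <= Fn t) (psi_ge0 : forall t, 0 <= psi t).
Hypothesis AH : \forall t \near +oo_R, A t <= H t.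
Hypothesis FnO : bigO_pinfty Fn (fun t => E C1 mu1 t).
Hypothesis AO : bigO_pinfty A (fun t => E C2 mu2 t).
Hypothesis Alow : \forall t \near +oo_R, C'' * expR (C2 * t) * t `^ mu3 <= A t.
Hypothesis HO : bigO_pinfty H (fun t => E C3 mu4 t).
Hypothesis psilow : (0 < limf_einf (fun t : R => (t `^ mu * psi t)%:E) +oo_R)%E.
Hypothesis psiO : bigO_pinfty psi (fun t => t `^ mu').
Hypothesis Tlarge : C1 + C3 - 2 * C2 < T.

Local Notation err t s := (K0 * ((1 + s) * (expR (- t * T) * Fn t) ^+ 2
  + (psi t * H t) ^+ 2 / s)).

(** Here and in [Iup], [s] is quantified inside the filter, so that it may be chosen as a function
    of [t]. *)
Hypothesis Ilow : \forall t \near +oo_R, forall s, 0 < s ->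
  kappa * (psi t * A t) ^+ 2 - err t s <= psi t * I t.
Hypothesis Iup : \forall t \near +oo_R, forall s, 0 < s ->
  psi t * I t <= K0 * (psi t * A t) ^+ 2 + err t s.

Let FnE : exists2 K, 0 < K & \forall t \near +oo_R, Fn t <= K * E C1 mu1 t.
Proof.
have [K K_gt0 h] := bigO_pinfty_le FnO; exists K => //.
by apply: filterS h => t; rewrite ger0_norm ?expR_powR_ge0.
Qed.

Let AE : exists2 K, 0 < K & \forall t \near +oo_R, A t <= K * E C2 mu2 t.
Proof.
have [K K_gt0 h] := bigO_pinfty_le AO; exists K => //.
by apply: filterS h => t; rewrite ger0_norm ?expR_powR_ge0.
Qed.

Let HE : exists2 K, 0 < K & \forall t \near +oo_R, H t <= K * E C3 mu4 t.
Proof.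
have [K K_gt0 h] := bigO_pinfty_le HO; exists K => //.
by apply: filterS h => t; rewrite ger0_norm ?expR_powR_ge0.
Qed.

Let psiE : exists2 K, 0 < K & \forall t \near +oo_R, psi t <= K * E 0 mu' t.
Proof.
have [K K_gt0 h] := bigO_pinfty_le psiO; exists K => //.
by apply: filterS h => t; rewrite ger0_norm ?powR_ge0// mul0r expR0 mul1r.
Qed.

Let psi_lowE :
  exists2 c, 0 < c & \forall t \near +oo_R, c * E 0 (- mu) t <= psi t.
Proof.
have [c c0 h] := limf_einf_gt0 psilow; exists c => //; near=> t.
have t0 : 0 < t by near: t; exact: nbhs_pinfty_gt.
rewrite mul0r expR0 mul1r powRN ler_pdivrMr ?powR_gt0// mulrC.
by near: t.
Unshelve. all: by end_near. Qed.

Let AlowE : \forall t \near +oo_R, C'' * E C2 mu3 t <= A t.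
Proof. by apply: filterS Alow => t; rewrite mulrA. Qed.

(** The gradient norm on D is at most the full H^1 norm, so their rates compare. With the condition
    on [T] this gives [C1 - T < C2]. *)
Let C2_le_C3 : C2 <= C3.
Proof.
have [K K_gt0 hK] := HE; apply: (exponent_le C''0 K_gt0 _ hK).
by apply: filterS2 AlowE AH => t; exact: le_trans.
Qed.

Let sq_le (x y : R) : 0 <= x -> x <= y -> x ^+ 2 <= y ^+ 2.
Proof. by move=> x0 xy; rewrite lerXn2r// nnegrE (le_trans x0). Qed.

(* The weight balances the two terms of [err]: both then have exponent
   [C1 + C3 - T < 2 * C2]. *)
Let weight t := expR ((T - C1 + C3) * t).

(** The three terms of [err] have rates [2 * C1 - 2 * T], [C1 + C3 - T] and again [C1 + C3 - T], all
    below [2 * C2]; the power [p] on the right is therefore arbitrary. *)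
Let err_negligible e p : 0 < e ->
  \forall t \near +oo_R, err t (weight t) <= e * E (2 * C2) p t.
Proof.
move=> e0.
have [Kf Kf0 hf] := FnE; have [Kh Kh0 hh] := HE; have [Kp Kp0 hp] := psiE.
have sK0 : 0 < K0 * (Kf ^+ 2 * 2 + (Kp * Kh) ^+ 2).
  by rewrite mulr_gt0// ltr_wpDr ?mulr_gt0 ?exprn_gt0// exprn_ge0// ?mulr_ge0// ltW.
(* Chosen so that the three bounds, with their constants [Kf ^+ 2], [Kf ^+ 2] and [(Kp * Kh) ^+ 2],
   add up to exactly [e]. *)
pose d := e / (K0 * (Kf ^+ 2 * 2 + (Kp * Kh) ^+ 2)).
have d0 : 0 < d by rewrite divr_gt0.
have [h1 h2] := (C2_le_C3, Tlarge).
(* This is where [C2 <= C3] enters: [T > C1 + C3 - 2 * C2 >= C1 - C2]. *)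
have CT : 2 * C1 - 2 * T < 2 * C2 by lra.
have CT' : C1 + C3 - T < 2 * C2 by lra.
near=> t.
have t0 : 0 < t by near: t; exact: nbhs_pinfty_gt.
have n1 : E (2 * C1 - 2 * T) (2 * mu1) t <= d * E (2 * C2) p t.
  by near: t; apply: expR_powR_negligible => //.
have n2 : E (C1 + C3 - T) (2 * mu1) t <= d * E (2 * C2) p t.
  by near: t; apply: expR_powR_negligible => //.
have n3 : E (C1 + C3 - T) (2 * mu' + 2 * mu4) t <= d * E (2 * C2) p t.
  by near: t; apply: expR_powR_negligible => //.
have Fb : (expR (- t * T) * Fn t) ^+ 2 <= Kf ^+ 2 * E (2 * C1 - 2 * T) (2 * mu1) t.
  have -> : Kf ^+ 2 * E (2 * C1 - 2 * T) (2 * mu1) t =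
      (expR (- t * T) * (Kf * E C1 mu1 t)) ^+ 2.
    have -> : E (2 * C1 - 2 * T) (2 * mu1) t =
        expR (- t * T) ^+ 2 * (E C1 mu1 t) ^+ 2; last by ring.
      rewrite !expr2 expR_powRM// mulrA -!expRD; congr (expR _ * _ `^ _); ring.
  apply: sq_le; first by rewrite mulr_ge0// expR_ge0.
  by rewrite ler_wpM2l ?expR_ge0//; near: t.
have Hb : (psi t * H t) ^+ 2 <= (Kp * Kh) ^+ 2 * E (2 * C3) (2 * mu' + 2 * mu4) t.
  have -> : E (2 * C3) (2 * mu' + 2 * mu4) t = (E 0 mu' t * E C3 mu4 t) ^+ 2.
    have -> : 2 * C3 = 0 + C3 + (0 + C3) by ring.
    have -> : 2 * mu' + 2 * mu4 = mu' + mu4 + (mu' + mu4) by ring.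
    by rewrite [RHS]expr2 !expR_powRM.
  rewrite -exprMn; apply: sq_le; first by rewrite mulr_ge0.
  by rewrite mulrACA ler_pM//; near: t.
have w0 : 0 < weight t by exact: expR_gt0.
have Fb' : weight t * (expR (- t * T) * Fn t) ^+ 2 <= Kf ^+ 2 * E (C1 + C3 - T) (2 * mu1) t.
  have -> : E (C1 + C3 - T) (2 * mu1) t = weight t * E (2 * C1 - 2 * T) (2 * mu1) t.
    by rewrite mulrA -expRD; congr (expR _ * _); ring.
  by rewrite [leRHS]mulrCA ler_pM2l.
have Hb' : (psi t * H t) ^+ 2 / weight t <=
    (Kp * Kh) ^+ 2 * E (C1 + C3 - T) (2 * mu' + 2 * mu4) t.
  rewrite ler_pdivrMr// -mulrA.
  have -> : E (C1 + C3 - T) (2 * mu' + 2 * mu4) t * weight t =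
      E (2 * C3) (2 * mu' + 2 * mu4) t.
    by rewrite mulrAC -expRD; congr (expR _ * _); ring.
  exact: Hb.
have -> : e = K0 * (Kf ^+ 2 * 2 + (Kp * Kh) ^+ 2) * d.
  by rewrite /d mulrCA divff ?mulr1// gt_eqF.
set X := d * E _ _ _ in n1 n2 n3 *.
have -> : K0 * (Kf ^+ 2 * 2 + (Kp * Kh) ^+ 2) * d * E (2 * C2) p t =
    K0 * (Kf ^+ 2 * X + Kf ^+ 2 * X + (Kp * Kh) ^+ 2 * X) by rewrite /X; ring.
rewrite ler_pM2l// mulrDl mul1r.
apply: lerD; [apply: lerD|].
- by apply: le_trans Fb _; rewrite ler_wpM2l// exprn_ge0// ltW.
- by apply: le_trans Fb' _; rewrite ler_wpM2l// exprn_ge0// ltW.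
- by apply: le_trans Hb' _; rewrite ler_wpM2l// exprn_ge0// mulr_ge0// ltW.
Unshelve. all: by end_near. Qed.

(** With [s = weight t] the error is negligible against the square of [psi t * A t], so
    [psi t * I t] has the rate [2 * C2] of that square. Dividing by [psi t], which is bounded above
    and below by powers of [t], leaves the rate unchanged. *)
Lemma cvg_indicator_rate :
  (((2 * t)^-1)%:E * lne (I t)%:E)%E @[t --> +oo_R] --> C2%:E.
Proof.
have [Ka Ka0 ha] := AE; have [Kp Kp0 hp] := psiE; have [c c0 hc] := psi_lowE.
(* [p] and [q] are the powers of [t] in the lower and upper bounds of the square of [psi t * A t].
   The constant [k] is half of the lower one; the error consumes the other half. *)
pose p := 2 * mu3 - 2 * mu.
pose q := 2 * mu2 + 2 * mu'.
pose k := kappa * (c * C'') ^+ 2 / 2.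
have k0 : 0 < k by rewrite /k !mulr_gt0 ?exprn_gt0 ?invr_gt0 ?mulr_gt0.
apply: (@cvg_log_rate _ _ (k / Kp) (p - mu')
  ((K0 * (Kp * Ka) ^+ 2 + 1) / c) (q + mu)); first by rewrite divr_gt0.
- near=> t.
  have t0 : 0 < t by near: t; exact: nbhs_pinfty_gt.
  have E0 a r : 0 < E a r t by rewrite mulr_gt0 ?expR_gt0 ?powR_gt0.
  have cp : c * E 0 (- mu) t <= psi t by near: t.
  have pp : psi t <= Kp * E 0 mu' t by near: t.
  have psi0 : 0 < psi t by apply: lt_le_trans cp; rewrite mulr_gt0.
  have lo : forall s, 0 < s ->
    kappa * (psi t * A t) ^+ 2 - err t s <= psi t * I t by near: t.
  have {lo} := lo _ (expR_gt0 ((T - C1 + C3) * t)).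
  have er : err t (weight t) <= k * E (2 * C2) p t by near: t; exact: err_negligible.
  have main : 2 * k * E (2 * C2) p t <= kappa * (psi t * A t) ^+ 2.
    have -> : 2 * k * E (2 * C2) p t =
        kappa * ((c * E 0 (- mu) t) * (C'' * E C2 mu3 t)) ^+ 2.
      have -> : E (2 * C2) p t = (E 0 (- mu) t * E C2 mu3 t) ^+ 2.
        have -> : 2 * C2 = 0 + C2 + (0 + C2) by ring.
        have -> : p = - mu + mu3 + (- mu + mu3) by rewrite /p; ring.
        by rewrite [RHS]expr2 !expR_powRM.
      by rewrite /k; field.
    rewrite ler_pM2l//; apply: sq_le.
      by rewrite !mulr_ge0 ?expR_ge0 ?powR_ge0// ltW.
    by rewrite ler_pM ?mulr_ge0 ?expR_ge0 ?powR_ge0 ?(ltW c0) ?(ltW C''0)//; near: t.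
  move=> lo.
  have {}lo : k * E (2 * C2) p t <= psi t * I t.
    (* Refolding [weight] makes [lo] and [er] share the same atoms for [lra]. *)
    rewrite -[err _ _]/(err t (weight t)) in lo; lra.
  have I0 : 0 < I t.
    by rewrite -(pmulr_rgt0 _ psi0); apply: lt_le_trans lo; rewrite mulr_gt0.
  have {}lo : k * E (2 * C2) p t <= Kp * E 0 mu' t * I t.
    by apply: le_trans lo _; rewrite ler_pM2r.
  have -> : k / Kp * E (2 * C2) (p - mu') t = k * E (2 * C2) p t / (Kp * E 0 mu' t).
    have <- : E (2 * C2) (p - mu') t * E 0 mu' t = E (2 * C2) p t.
      by rewrite expR_powRM// addr0 subrK.
    by field; rewrite !gt_eqF ?expR_gt0 ?powR_gt0.
  by rewrite ler_pdivrMr ?mulr_gt0 ?expR_gt0 ?powR_gt0// [leRHS]mulrC.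
- near=> t.
  have t0 : 0 < t by near: t; exact: nbhs_pinfty_gt.
  have E0 a r : 0 < E a r t by rewrite mulr_gt0 ?expR_gt0 ?powR_gt0.
  have cp : c * E 0 (- mu) t <= psi t by near: t.
  have psi0 : 0 < psi t by apply: lt_le_trans cp; rewrite mulr_gt0.
  have up : forall s, 0 < s ->
    psi t * I t <= K0 * (psi t * A t) ^+ 2 + err t s by near: t.
  have {up} := up _ (expR_gt0 ((T - C1 + C3) * t)) => up.
  have er : err t (weight t) <= 1 * E (2 * C2) q t by near: t; exact: err_negligible.
  have main : K0 * (psi t * A t) ^+ 2 <= K0 * (Kp * Ka) ^+ 2 * E (2 * C2) q t.
    have -> : K0 * (Kp * Ka) ^+ 2 * E (2 * C2) q t =
        K0 * ((Kp * E 0 mu' t) * (Ka * E C2 mu2 t)) ^+ 2.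
      have -> : E (2 * C2) q t = (E 0 mu' t * E C2 mu2 t) ^+ 2.
        have -> : 2 * C2 = 0 + C2 + (0 + C2) by ring.
        have -> : q = mu' + mu2 + (mu' + mu2) by rewrite /q; ring.
        by rewrite [RHS]expr2 !expR_powRM.
      by ring.
    rewrite ler_pM2l//; apply: sq_le; first by rewrite mulr_ge0.
    by rewrite ler_pM//; near: t.
  have {}up : psi t * I t <= (K0 * (Kp * Ka) ^+ 2 + 1) * E (2 * C2) q t.
    rewrite -[err _ _]/(err t (weight t)) in up; lra.
  have -> : (K0 * (Kp * Ka) ^+ 2 + 1) / c * E (2 * C2) (q + mu) t =
      (K0 * (Kp * Ka) ^+ 2 + 1) * E (2 * C2) q t / (c * E 0 (- mu) t).
    have <- : E (2 * C2) (q + mu) t * E 0 (- mu) t = E (2 * C2) q t.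
      by rewrite expR_powRM// addr0 addrK.
    by field; rewrite !gt_eqF ?expR_gt0 ?powR_gt0.
  rewrite ler_pdivlMr ?mulr_gt0 ?expR_gt0 ?powR_gt0//.
  (* No sign of [I] is assumed here: for negative [I t] the left side is nonpositive while the right
     side is nonnegative. *)
  have [I0|I0] := leP 0 (I t).
    by apply: le_trans up; rewrite [leRHS]mulrC ler_wpM2l.
  apply: (@le_trans _ _ 0); last first.
    by rewrite mulr_ge0 ?(ltW (E0 _ _))// addr_ge0// mulr_ge0 ?exprn_ge0 ?mulr_ge0// ltW.
  by rewrite nmulr_rle0// mulr_ge0 ?(ltW c0) ?(ltW (E0 _ _)).
Unshelve. all: by end_near. Qed.

End rate_of_indicator.

(** * Pointwise inequalities *)

Section bilinear_form.
Context (R : realType) (n : nat).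
Implicit Types (M N : 'M[R]_n) (p q r : 'I_n -> R).

Definition bil M p q : R := \sum_i \sum_j M i j * p j * q i.

Definition sqn p : R := \sum_i p i ^+ 2.

Lemma sqn_ge0 p : 0 <= sqn p.
Proof. by apply: sumr_ge0 => i _; rewrite sqr_ge0. Qed.

Lemma bilBl M p q r : bil M (p \- q) r = bil M p r - bil M q r.
Proof.
rewrite /bil -sumrB; apply: eq_bigr => i _; rewrite -sumrB.
by apply: eq_bigr => j _ /=; ring.
Qed.

Lemma bilBr M p q r : bil M p (q \- r) = bil M p q - bil M p r.
Proof.
rewrite /bil -sumrB; apply: eq_bigr => i _; rewrite -sumrB.
by apply: eq_bigr => j _ /=; ring.
Qed.

Lemma bilNr M p q : bil M p (\- q) = - bil M p q.
Proof.
rewrite /bil -sumrN; apply: eq_bigr => i _; rewrite -sumrN.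
by apply: eq_bigr => j _ /=; ring.
Qed.

Lemma bilNl M p q : bil M (\- p) q = - bil M p q.
Proof.
rewrite /bil -sumrN; apply: eq_bigr => i _; rewrite -sumrN.
by apply: eq_bigr => j _ /=; ring.
Qed.

Lemma bil_subm M N p q : bil (M - N) p q = bil M p q - bil N p q.
Proof.
rewrite /bil -sumrB; apply: eq_bigr => i _; rewrite -sumrB.
by apply: eq_bigr => j _ /=; rewrite !mxE; ring.
Qed.

Lemma bil_sym M p q : M^T = M -> bil M p q = bil M q p.
Proof.
move=> sM; rewrite /bil exchange_big; apply: eq_bigr => i _.
by apply: eq_bigr => j _; rewrite -[in LHS]sM mxE; ring.
Qed.

Lemma bil_scalar (a : R) p q : bil a%:M p q = a * \sum_i p i * q i.
Proof.
rewrite /bil mulr_sumr; apply: eq_bigr => i _.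
rewrite (bigD1 i)//= big1 ?addr0 => [|j ji].
  by rewrite mxE eqxx mulr1n mulrA.
by rewrite mxE eq_sym (negbTE ji) mulr0n !mul0r.
Qed.

Lemma bil_scalar_sqn (a : R) p : bil a%:M p p = a * sqn p.
Proof. by rewrite bil_scalar. Qed.

Lemma quad_bil M (xi : 'cV[R]_n) : quad M xi = bil M (xi^~ ord0) (xi^~ ord0).
Proof. by apply: eq_bigr => i _; rewrite mxE mulr_suml. Qed.

Lemma bil_quad M p : bil M p p = quad M (\col_i p i).
Proof.
rewrite quad_bil; apply: eq_bigr => i _; apply: eq_bigr => j _.
by rewrite !mxE.
Qed.

Lemma sqn_sqrnorm p : sqn p = sqrnorm (\col_i p i).
Proof. by apply: eq_bigr => i _; rewrite mxE. Qed.

(** Expand the squares of [s * x - y] and [s * x + y], divided by [s]; the two signs give the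
    absolute value. *)
Lemma ler_amgm (s x y : R) : 0 < s -> `|x * y| <= (s * x ^+ 2 + y ^+ 2 / s) / 2.
Proof.
move=> s0; have sv : s * s^-1 = 1 by rewrite divff// gt_eqF.
have s'0 : 0 < s^-1 by rewrite invr_gt0.
have h1 : 0 <= s^-1 * (s * x - y) ^+ 2 by rewrite mulr_ge0 ?sqr_ge0// ltW.
have h2 : 0 <= s^-1 * (s * x + y) ^+ 2 by rewrite mulr_ge0 ?sqr_ge0// ltW.
have e1 : s^-1 * (s * x - y) ^+ 2 = s * x ^+ 2 * (s * s^-1) + y ^+ 2 / s - 2 * (x * y) * (s * s^-1).
  by ring.
have e2 : s^-1 * (s * x + y) ^+ 2 = s * x ^+ 2 * (s * s^-1) + y ^+ 2 / s + 2 * (x * y) * (s * s^-1).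
  by ring.
by rewrite ler_norml; rewrite e1 e2 sv in h1 h2; apply/andP; split; lra.
Qed.

(** Entrywise AM-GM with weight [s]; summing over both indices produces the factor [n]. *)
Lemma le_norm_bil M (L s : R) p q : 0 < s -> (forall i j, `|M i j| <= L) ->
  `|bil M p q| <= L * n%:R * (s * sqn p + sqn q / s).
Proof.
(* A negative [L] cannot bound an absolute value, so there are no indices and both sides vanish. *)
move=> s0 hM; have [L0|L0] := ltP L 0.
  have [i|] := pickP (fun _ : 'I_n => true).
    by have := le_trans (normr_ge0 _) (hM i i); rewrite leNgt L0.
  move=> h; have := normr_ge0 (bil M p q).
  by rewrite /bil /sqn !big_pred0// normr0 mulr0 mul0r addr0 mulr0.
apply: (@le_trans _ _ (\sum_i \sum_j L * ((s * p j ^+ 2 + q i ^+ 2 / s) / 2))).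
  apply: (le_trans (ler_norm_sum _ _ _)); apply: ler_sum => i _.
  apply: (le_trans (ler_norm_sum _ _ _)); apply: ler_sum => j _.
  rewrite -mulrA normrM; apply: ler_pM => //; exact: ler_amgm.
have -> : \sum_i \sum_j L * ((s * p j ^+ 2 + q i ^+ 2 / s) / 2) =
    L * n%:R * ((s * sqn p + sqn q / s) / 2).
  have cst (x : R) : \sum_(i < n) x = n%:R * x by rewrite sumr_const card_ord mulr_natl.
  under eq_bigr do rewrite -mulr_sumr -mulr_suml big_split/= -mulr_sumr cst.
  rewrite -mulr_sumr -mulr_suml big_split/= cst -mulr_sumr -mulr_suml.
  by rewrite -/(sqn p) -/(sqn q); ring.
have X0 : 0 <= s * sqn p + sqn q / s.
  by rewrite addr_ge0// ?mulr_ge0 ?sqn_ge0 ?invr_ge0 ?(ltW s0).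
rewrite ler_wpM2l ?mulr_ge0//; lra.
Qed.

Lemma bil_expand M p q : M^T = M ->
  bil M (p \- q) (p \- q) = bil M p p - 2 * bil M p q + bil M q q.
Proof.
by move=> sM; rewrite bilBl !bilBr (bil_sym q p sM); ring.
Qed.

(** In each coordinate, twice the gap between the sides is the square of [2 * q i - p i]. *)
Lemma half_sqn_le p q : sqn p / 2 <= sqn (q \- p) + sqn q.
Proof.
rewrite /sqn -big_split mulr_suml; apply: ler_sum => i _ /=.
by have := sqr_ge0 (2 * q i - p i); rewrite !expr2; nra.
Qed.

Lemma sqn_sub_le p q : sqn q <= 2 * sqn (q \- p) + 2 * sqn p.
Proof.
rewrite /sqn !mulr_sumr -big_split; apply: ler_sum => i _ /=.
by have := sqr_ge0 (q i - 2 * p i); rewrite !expr2; nra.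
Qed.

End bilinear_form.

(** * Completing the square at a point, for complex gradients *)

Section pointwise.
Context (R : realType) (n : nat).
Implicit Types (M : 'M[R]_n) (a b : 'I_n -> R[i]) (z : R[i]).
Local Notation Re := (@complex.Re R).
Local Notation Im := (@complex.Im R).
Local Notation rp a := (fun i => Re (a i)).
Local Notation ip a := (fun i => Im (a i)).

(** [flux_dot] at a single point, convertible with it so that Green's formulas can be folded into
    this form. *)
Definition cdot M a b : R[i] := \sum_i \sum_j (M i j)%:C%C * a j * b i.

Definition csqn a : R := \sum_i normc (a i) ^+ 2.

Lemma cReD z z' : Re (z + z') = Re z + Re z'. Proof. by case: z; case: z'. Qed.
Lemma cImD z z' : Im (z + z') = Im z + Im z'. Proof. by case: z; case: z'. Qed.
Lemma cReN z : Re (- z) = - Re z. Proof. by case: z. Qed.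
Lemma cImN z : Im (- z) = - Im z. Proof. by case: z. Qed.
Lemma cReM z z' : Re (z * z') = Re z * Re z' - Im z * Im z'.
Proof. by case: z; case: z'. Qed.
Lemma cImM z z' : Im (z * z') = Re z * Im z' + Im z * Re z'.
Proof. by case: z; case: z'. Qed.
Lemma cRe_sum I (r : seq I) (P : pred I) (F : I -> R[i]) :
  Re (\sum_(i <- r | P i) F i) = \sum_(i <- r | P i) Re (F i).
Proof. exact: (big_morph _ cReD). Qed.
Lemma cIm_sum I (r : seq I) (P : pred I) (F : I -> R[i]) :
  Im (\sum_(i <- r | P i) F i) = \sum_(i <- r | P i) Im (F i).
Proof. exact: (big_morph _ cImD). Qed.
Lemma cRe_conj z : Re (conjc z) = Re z. Proof. by case: z. Qed.
Lemma cIm_conj z : Im (conjc z) = - Im z. Proof. by case: z. Qed.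

Lemma sqr_normcE z : normc z ^+ 2 = Re z ^+ 2 + Im z ^+ 2.
Proof. by case: z => x y /=; rewrite sqr_sqrtr// addr_ge0 ?sqr_ge0. Qed.

Lemma normc_ge0 z : 0 <= normc z.
Proof. by case: z => x y /=; exact: sqrtr_ge0. Qed.

Lemma normc_conj z : normc (conjc z) = normc z.
Proof. by case: z => x y /=; rewrite sqrrN. Qed.

Lemma normr_Re_le z : `|Re z| <= normc z.
Proof.
case: z => x y /=; rewrite -sqrtr_sqr ler_sqrt ?addr_ge0 ?sqr_ge0//.
by rewrite lerDl sqr_ge0.
Qed.

Lemma normr_Im_le z : `|Im z| <= normc z.
Proof.
case: z => x y /=; rewrite -sqrtr_sqr ler_sqrt ?addr_ge0 ?sqr_ge0//.
by rewrite lerDr sqr_ge0.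
Qed.

Lemma normc_le z : normc z <= `|Re z| + `|Im z|.
Proof.
rewrite -(@ler_pXn2r _ 2)// ?nnegrE ?normc_ge0 ?addr_ge0//.
rewrite sqr_normcE sqrrD !real_normK ?num_real//.
by rewrite lerD2r lerDl mulrn_wge0// mulr_ge0.
Qed.

Lemma csqnE a : csqn a = sqn (rp a) + sqn (ip a).
Proof. by rewrite /csqn /sqn -big_split; apply: eq_bigr => i _; exact: sqr_normcE. Qed.

Lemma csqn_ge0 a : 0 <= csqn a.
Proof. by apply: sumr_ge0 => i _; rewrite sqr_ge0. Qed.

Lemma Re_cdot M a b : Re (cdot M a b) = bil M (rp a) (rp b) - bil M (ip a) (ip b).
Proof.
rewrite /cdot /bil cRe_sum -sumrB; apply: eq_bigr => i _.
rewrite cRe_sum -sumrB; apply: eq_bigr => j _.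
by rewrite !(cReM, cImM)/=; ring.
Qed.

Lemma Im_cdot M a b : Im (cdot M a b) = bil M (rp a) (ip b) + bil M (ip a) (rp b).
Proof.
rewrite /cdot /bil cIm_sum -big_split; apply: eq_bigr => i _.
rewrite cIm_sum -big_split; apply: eq_bigr => j _ /=.
by rewrite !(cReM, cImM)/=; ring.
Qed.

Lemma rp_conj a : rp (fun i => conjc (a i)) = rp a.
Proof. by apply: funext => i; rewrite cRe_conj. Qed.

Lemma ip_conj a : ip (fun i => conjc (a i)) = \- (ip a).
Proof. by apply: funext => i; rewrite cIm_conj. Qed.

Lemma rp_sub a b : rp (fun i => a i - b i) = rp a \- rp b.
Proof. by apply: funext => i; rewrite /= cReD cReN. Qed.

Lemma ip_sub a b : ip (fun i => a i - b i) = ip a \- ip b.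
Proof. by apply: funext => i; rewrite /= cImD cImN. Qed.

(** Values at one point: [M] and [g0] are those of gamma and gamma_0, and [d] tells whether the
    point lies in D. The two cases of [d] replace a splitting of the integrals. *)
Context (M : 'M[R]_n) (g0 : R) (d : bool) (L C m C' : R).
Hypotheses (M_sym : M^T = M) (L_ge0 : 0 <= L) (C_gt0 : 0 < C).
Hypothesis M_bound : forall i j, `|(M - g0%:M) i j| <= L.
Hypothesis M_elliptic : forall p, C * sqn p <= bil M p p.
Hypothesis M_out : ~~ d -> M = g0%:M.
Hypotheses (m_gt0 : 0 < m) (g0_ge : m <= g0) (C'_gt0 : 0 < C').

Local Notation P := (M - g0%:M).
Implicit Types p q u w : 'I_n -> R.

Let bil_P p q : bil M p q = bil P p q + bil g0%:M p q.
Proof. by rewrite bil_subm subrK. Qed.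

Let bil_out p q : ~~ d -> bil P p q = 0.
Proof. by move=> /M_out ->; rewrite bil_subm subrr. Qed.

(** The right side equals [bil M (w \- u) (w \- u) - bil P u u]; the first term is nonnegative by
    ellipticity and the second is the jump, which vanishes outside D. *)
Let bil_A1 u w : (d -> forall p, C' * sqn p <= - bil P p p) ->
  C' * (d%:R * sqn u) <= bil M w w - 2 * bil M w u + g0 * sqn u.
Proof.
move=> A1; have := M_elliptic (w \- u); rewrite bil_expand//.
have := mulr_ge0 (ltW C_gt0) (sqn_ge0 (w \- u)).
have := bil_P u u; rewrite bil_scalar_sqn.
have : C' * (d%:R * sqn u) <= - bil P u u.
  case: (boolP d) => [dT|dF]; first by rewrite mul1r; exact: A1.
  by rewrite bil_out// mul0r mulr0 oppr0.
by lra.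
Qed.

(** The right side equals [g0 * sqn (w \- u) + bil P w w]. The jump controls [w] instead of [u]
    here, so [half_sqn_le] recovers [u] from [w] and [w \- u]; this is the origin of the factor 1/2
    and of the minimum. *)
Let bil_A2 u w : (d -> forall p, C' * sqn p <= bil P p p) ->
  Num.min m C' / 2 * (d%:R * sqn u) <=
  g0 * sqn u - 2 * bil g0%:M u w + bil M w w.
Proof.
move=> A2.
have mC0 : 0 <= Num.min m C' by rewrite le_min !ltW.
have h1 : Num.min m C' * sqn (w \- u) <= g0 * sqn (w \- u).
  by rewrite ler_wpM2r ?sqn_ge0//; apply: le_trans g0_ge; rewrite ge_min lexx.
have h2 : d%:R * (Num.min m C' * sqn w) <= bil P w w.
  case: (boolP d) => [dT|dF]; last by rewrite bil_out// mul0r.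
  rewrite mul1r; apply: le_trans (A2 dT _).
  by rewrite ler_wpM2r ?sqn_ge0// ge_min lexx orbT.
have h3 : Num.min m C' / 2 * (d%:R * sqn u) <=
    Num.min m C' * sqn (w \- u) + d%:R * (Num.min m C' * sqn w).
  case: (boolP d) => _; last first.
    by rewrite !mul0r mulr0 addr0 mulr_ge0// sqn_ge0.
  rewrite !mul1r -mulrDr -mulrA ler_wpM2l//.
  by rewrite mulrC; exact: half_sqn_le.
have h4 : g0 * sqn (w \- u) = g0 * sqn w - 2 * bil g0%:M u w + g0 * sqn u.
  rewrite -!bil_scalar_sqn bil_expand ?tr_scalar_mx//.
  by rewrite (@bil_sym _ _ _ u w) ?tr_scalar_mx//; ring.
have := bil_P w w; rewrite bil_scalar_sqn; lra.
Qed.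

(* AM-GM weight making the cross term absorb half of the ellipticity. *)
Definition cross_weight := 2 * (L * n%:R) / C + 1.

Lemma cross_weight_gt0 : 0 < cross_weight.
Proof. by rewrite ltr_wpDl// divr_ge0 ?mulr_ge0// ltW. Qed.

(** With e = w - u, the right side is [M e . e + P u . e]. The cross term lives on D, and
    [cross_weight] is large enough for its part in e to be at most [C / 2 * sqn e]. *)
Let bil_energy u w :
  C / 2 * sqn (w \- u) - L * n%:R * cross_weight * (d%:R * sqn u) <=
  bil M w (w \- u) - bil g0%:M u (w \- u).
Proof.
have s0 := cross_weight_gt0.
have e1 : bil M w (w \- u) - bil g0%:M u (w \- u) =
    bil M (w \- u) (w \- u) + bil P u (w \- u).
  by rewrite [bil M (_ \- _) _]bilBl bil_subm; ring.
have h : - bil P u (w \- u) <=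
    L * n%:R * cross_weight * (d%:R * sqn u) + C / 2 * sqn (w \- u).
  have [dT|dF] := boolP d; last first.
    rewrite bil_out// oppr0 mul0r mulr0 add0r mulr_ge0 ?sqn_ge0//.
    by rewrite divr_ge0// ltW.
  apply: (le_trans (ler_norm _)); rewrite normrN mul1r.
  apply: (le_trans (le_norm_bil _ _ s0 M_bound)).
  rewrite mulrDr [_ * (cross_weight * _)]mulrA lerD2l.
  rewrite mulrCA [leRHS]mulrC ler_wpM2l ?sqn_ge0// ler_pdivrMr//.
  rewrite /cross_weight mulrDr mulr1.
  have -> : C / 2 * (2 * (L * n%:R) / C) = L * n%:R by field; rewrite gt_eqF.
  by rewrite lerDl divr_ge0// ltW.
by have := M_elliptic (w \- u); lra.
Qed.

Let bil_upper u w : `|bil P w u| <= L * n%:R * d%:R * (sqn w + sqn u).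
Proof.
have [dT|dF] := boolP d; last by rewrite bil_out// normr0 mulr0 mul0r.
apply: (le_trans (le_norm_bil _ _ ltr01 M_bound)).
by rewrite mulr1 mul1r divr1.
Qed.

Context (a b : 'I_n -> R[i]) (ww uu ff : R[i]) (tau s : R).
Hypotheses (tau_gt0 : 0 < tau) (s_gt0 : 0 < s).

Local Notation cj a := (fun i => conjc (a i)).
Local Notation "x ^-" := (conjc x) (at level 2).
Local Notation tc := (tau%:C%C).
(** Integrands of Green's formula, where [a], [b] are the gradients of w and u, and [ww], [uu], [ff]
    the values of w, u and F'. The equation of w is tested with conj u in [f1] and conj w in [f3],
    that of u with conj u in [f2] and conj w in [f4], that of conj u with w in [f5]. *)
Local Notation f1 := (cdot M a (cj b) + (tc * ww + ff) * uu^-).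
Local Notation f2 := (cdot g0%:M b (cj b) + tc * uu * uu^-).
Local Notation f3 := (cdot M a (cj a) + (tc * ww + ff) * ww^-).
Local Notation f4 := (cdot g0%:M b (cj a) + tc * uu * ww^-).
Local Notation f5 := (cdot g0%:M (cj b) a + tc * uu^- * ww).

(** AM-GM with weight [tau^-1]: the zeroth-order term absorbs the source tested against w - u. *)
Let scalar_low (x y z : R) :
  - (z ^+ 2 / tau) <= tau * (x - y) ^+ 2 + z * (x - y).
Proof.
have := ler_amgm z (x - y) (_ : 0 < tau^-1); rewrite invr_gt0 => /(_ tau_gt0).
rewrite invrK ler_norml => /andP[+ _].
have := mulr_ge0 (ltW tau_gt0) (sqr_ge0 (x - y)).
have : 0 <= tau^-1 * z ^+ 2 by rewrite mulr_ge0 ?sqr_ge0// invr_ge0 ltW.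
lra.
Qed.

Let amgm_s (x y : R) : `|x * y| <= s * x ^+ 2 + y ^+ 2 / s.
Proof.
apply: le_trans (ler_amgm x y s_gt0) _.
have : 0 <= s * x ^+ 2 by rewrite mulr_ge0 ?sqr_ge0// ltW.
have : 0 <= y ^+ 2 / s by rewrite mulr_ge0 ?sqr_ge0// invr_ge0 ltW.
lra.
Qed.

Let amgm_l x y : - (s * x ^+ 2 + y ^+ 2 / s) <= x * y.
Proof. by have := amgm_s x y; rewrite ler_norml => /andP[]. Qed.

Let amgm_r x y : x * y <= s * x ^+ 2 + y ^+ 2 / s.
Proof. by have := amgm_s x y; rewrite ler_norml => /andP[]. Qed.

Local Notation lowbound k := (k * (d%:R * csqn b)
  - ((tau^-1 + s) * normc ff ^+ 2 + normc uu ^+ 2 / s)).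

(** As [M] is real and symmetric, real and imaginary parts separate and [bil_A1] applies to each.
    The source contributes F' conj (w - u), handled by [scalar_low], minus F' conj u, handled by
    AM-GM with weight [s]. *)
Lemma pointwise_A1 : (d -> forall p, C' * sqn p <= - bil P p p) ->
  lowbound C' <= Re f3 + Re f2 - 2 * Re f1.
Proof.
move=> A1; rewrite !cReD !Re_cdot !rp_conj !ip_conj !bilNr !sqr_normcE csqnE.
rewrite !bil_scalar_sqn.
have := bil_A1 (rp b) (rp a) A1; have := bil_A1 (ip b) (ip a) A1.
have := scalar_low (Re ww) (Re uu) (Re ff); have := scalar_low (Im ww) (Im uu) (Im ff).
have := amgm_r (Re ff) (Re uu); have := amgm_r (Im ff) (Im uu).
rewrite !(cReM, cImM, cReD, cImD, cRe_conj, cIm_conj)/=; lra.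
Qed.

(** As under (A1), with [bil_A2]; now the source is tested with conj w, split as conj (w - u) plus
    conj u. *)
Lemma pointwise_A2 : (d -> forall p, C' * sqn p <= bil P p p) ->
  lowbound (Num.min m C' / 2) <= Re f2 + Re f3 - 2 * Re f4.
Proof.
move=> A2; rewrite !cReD !Re_cdot !rp_conj !ip_conj !bilNr !sqr_normcE csqnE.
rewrite !bil_scalar_sqn.
have := bil_A2 (rp b) (rp a) A2; have := bil_A2 (ip b) (ip a) A2.
have := scalar_low (Re ww) (Re uu) (Re ff); have := scalar_low (Im ww) (Im uu) (Im ff).
have := amgm_l (Re ff) (Re uu); have := amgm_l (Im ff) (Im uu).
rewrite !(cReM, cImM, cReD, cImD, cRe_conj, cIm_conj)/=; lra.
Qed.

(** The combination on the right is the difference of the two equations tested with conj (w - u);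
    its integral will vanish. *)
Lemma pointwise_energy :
  C / 2 * csqn (fun i => a i - b i)
    - L * n%:R * cross_weight * (d%:R * csqn b) - normc ff ^+ 2 / tau <=
  Re f3 - Re f4 - Re f1 + Re f2.
Proof.
rewrite !cReD !Re_cdot !rp_conj !ip_conj !bilNr !sqr_normcE !csqnE.
rewrite rp_sub ip_sub.
have := bil_energy (rp b) (rp a); have := bil_energy (ip b) (ip a).
have := scalar_low (Re ww) (Re uu) (Re ff); have := scalar_low (Im ww) (Im uu) (Im ff).
rewrite !bilBr !(cReM, cImM, cReD, cImD, cRe_conj, cIm_conj)/=; lra.
Qed.

Local Notation upbound := (L * n%:R * (3 * (d%:R * csqn b)
   + 2 * csqn (fun i => a i - b i)) + (s * normc ff ^+ 2 + normc uu ^+ 2 / s)).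

(** Trades grad w for grad u and grad (w - u); the factor [d] is kept on grad u, whose norm is known
    only on D. *)
Let upper_le : L * n%:R * d%:R * (csqn a + csqn b) <=
  L * n%:R * (3 * (d%:R * csqn b) + 2 * csqn (fun i => a i - b i)).
Proof.
rewrite -mulrA ler_wpM2l ?mulr_ge0//.
have : csqn a <= 2 * csqn (fun i => a i - b i) + 2 * csqn b.
  rewrite !csqnE rp_sub ip_sub.
  by have := sqn_sub_le (rp b) (rp a); have := sqn_sub_le (ip b) (ip a); lra.
have := csqn_ge0 (fun i => a i - b i).
by case: d => /=; rewrite ?mul1r ?mul0r ?mulr0; lra.
Qed.

(** In [f1 - f5] the terms in [g0] and [tau] cancel, leaving the jump [P] applied to [a] and conj
    [b], and the source times conj [uu]. *)
Lemma pointwise_upper_Re : `|Re (f1 - f5)| <= upbound.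
Proof.
have -> : Re (f1 - f5) = (bil P (rp a) (rp b) + bil P (ip a) (ip b))
    + (Re ff * Re uu + Im ff * Im uu).
  rewrite !(cReD, cReN) !Re_cdot !rp_conj !ip_conj !bilNr !bilNl !bil_subm.
  rewrite (@bil_sym _ _ _ (rp b)) ?tr_scalar_mx// (@bil_sym _ _ _ (ip b)) ?tr_scalar_mx//.
  by rewrite !(cReM, cImM, cReD, cImD, cRe_conj, cIm_conj)/=; ring.
apply: le_trans (ler_normD _ _) (lerD _ _).
  apply: le_trans (ler_normD _ _) _; apply: le_trans upper_le; rewrite !csqnE.
  by have := bil_upper (rp b) (rp a); have := bil_upper (ip b) (ip a); lra.
apply: le_trans (ler_normD _ _) _; rewrite !sqr_normcE.
by have := amgm_s (Re ff) (Re uu); have := amgm_s (Im ff) (Im uu); lra.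
Qed.

Lemma pointwise_upper_Im : `|Im (f1 - f5)| <= upbound.
Proof.
have -> : Im (f1 - f5) = (bil P (ip a) (rp b) - bil P (rp a) (ip b))
    + (Im ff * Re uu - Re ff * Im uu).
  rewrite !(cImD, cImN) !Im_cdot !rp_conj !ip_conj !bilNr !bilNl !bil_subm.
  rewrite (@bil_sym _ _ _ (rp b)) ?tr_scalar_mx// (@bil_sym _ _ _ (ip b)) ?tr_scalar_mx//.
  by rewrite !(cReM, cImM, cReD, cImD, cRe_conj, cIm_conj)/=; ring.
apply: le_trans (ler_normD _ _) (lerD _ _).
  apply: le_trans (ler_normB _ _) _; apply: le_trans upper_le; rewrite !csqnE.
  by have := bil_upper (rp b) (ip a); have := bil_upper (ip b) (rp a); lra.
apply: le_trans (ler_normB _ _) _; rewrite !sqr_normcE.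
by have := amgm_s (Im ff) (Re uu); have := amgm_s (Re ff) (Im uu); lra.
Qed.

End pointwise.

(** * Integration of complex-valued functions *)

Section real_integrals.
Context d (T : measurableType d) (R : realType) (mu : {measure set T -> \bar R}).
Context (D : set T) (mD : measurable D).
Implicit Types (f g : T -> R).

Local Notation Int f := (mu.-integrable D (EFin \o f)).

(** True for arbitrary [f]: negation swaps the integrals of the positive and negative parts, and
    [fine] sends infinite values to 0. Hence conjugation commutes with [cintegral]
    unconditionally. *)
Lemma Rintegral_opp f :
  \int[mu]_(x in D) (- f x) = - \int[mu]_(x in D) f x.
Proof.
rewrite /Rintegral -fineN; under [X in fine X]eq_integral do rewrite EFinN.
set F := fun x => (f x)%:E.
rewrite (integralE mu D F) (integralE mu D (\- F)%E) funeposN funenegN.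
have := @integral_ge0 _ _ _ mu D _ (fun x _ => funepos_ge0 F x).
have := @integral_ge0 _ _ _ mu D _ (fun x _ => funeneg_ge0 F x).
move: (\int[mu]_(x in D) F^\+ x)%E (\int[mu]_(x in D) F^\- x)%E.
by move=> [a| |] [b| |] //= _ _; rewrite opprB.
Qed.

Lemma RintD f g : Int f -> Int g -> Int (fun x => f x + g x).
Proof.
move=> fi gi; have := integrableD mD fi gi.
by apply: eq_integrable => // x _ /=; rewrite EFinD.
Qed.

Lemma RintZ (k : R) f : Int f -> Int (fun x => k * f x).
Proof.
move=> fi; have := integrableZl mD k fi.
by apply: eq_integrable => // x _ /=; rewrite EFinM.
Qed.

Lemma RintN f : Int f -> Int (fun x => - f x).
Proof.
move=> fi; have := integrableN fi.
by apply: eq_integrable => // x _ /=; rewrite EFinN.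
Qed.

Lemma RintB f g : Int f -> Int g -> Int (fun x => f x - g x).
Proof. by move=> fi gi; apply: RintD => //; exact: RintN. Qed.

Lemma Rint_sum (I : Type) (s : seq I) (h : I -> T -> R) :
  (forall i, Int (h i)) -> Int (fun x => \sum_(i <- s) h i x).
Proof.
move=> hi; elim: s => [|i s ih].
  under [X in mu.-integrable _ X]eq_fun do rewrite /= big_nil.
  exact: integrable0.
under [X in mu.-integrable _ X]eq_fun do rewrite /= big_cons.
exact: RintD.
Qed.

Lemma Rintegral_sum (I : Type) (s : seq I) (h : I -> T -> R) :
  (forall i, Int (h i)) ->
  \int[mu]_(x in D) (\sum_(i <- s) h i x) = \sum_(i <- s) \int[mu]_(x in D) h i x.
Proof.
move=> hi; elim: s => [|i s ih].
  rewrite big_nil -[RHS](_ : \int[mu]_(x in D) 0 = 0); last first.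
    by rewrite /Rintegral integral0.
  by apply: eq_Rintegral => x _; rewrite big_nil.
rewrite big_cons -ih -RintegralD//; last exact: Rint_sum.
by apply: eq_Rintegral => x _; rewrite big_cons.
Qed.

Lemma ae_le_integrable f g : measurable_fun D f -> Int g ->
  {ae mu, forall x, D x -> `|f x| <= g x} -> Int f.
Proof.
move=> mf gi fg; apply/integrableP; split; first exact/measurable_EFinP.
have /integrableP[mg] := gi; apply: le_lt_trans.
apply: ae_ge0_le_integral => //.
- by apply: measurableT_comp => //; exact/measurable_EFinP.
- exact: measurableT_comp.
- apply: filterS fg => x + Dx => /(_ Dx) fgx /=.
  by rewrite lee_fin (le_trans fgx)// ler_norm.
Qed.

(** The function [g - f] agrees almost everywhere with its absolute value, whose integral is
    nonnegative. *)
Lemma ae_le_Rintegral f g : Int f -> Int g ->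
  {ae mu, forall x, D x -> f x <= g x} ->
  \int[mu]_(x in D) f x <= \int[mu]_(x in D) g x.
Proof.
move=> fi gi fg.
have gfi : Int (fun x => g x - f x) by exact: RintB.
rewrite -subr_ge0 -RintegralB//.
suff -> : \int[mu]_(x in D) (g x - f x) = \int[mu]_(x in D) `|g x - f x|.
  by apply: Rintegral_ge0.
congr fine; have mgf := measurable_int _ gfi.
apply: ae_eq_integral => //.
  by apply/measurable_EFinP; apply: measurableT_comp => //; exact/measurable_EFinP.
apply: filterS fg => x + Dx => /(_ Dx) fgx /=.
by rewrite ger0_norm// subr_ge0.
Qed.

End real_integrals.

Section complex_integrals.
Context d (T : measurableType d) (R : realType) (mu : {measure set T -> \bar R}).
Context (D : set T) (mD : measurable D).
Implicit Types (f g : T -> R[i]) (h k : T -> R).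
Local Notation Int f := (mu.-integrable D (EFin \o f)).

Definition cintegrable f :=
  Int (fun x => complex.Re (f x)) /\ Int (fun x => complex.Im (f x)).

Lemma cintegral_conj f :
  cintegral mu D (fun x => conjc (f x)) = conjc (cintegral mu D f).
Proof.
rewrite /cintegral /=; congr (_ +i* _)%C.
  by apply: eq_Rintegral => x _; rewrite cRe_conj.
by rewrite -Rintegral_opp; apply: eq_Rintegral => x _; rewrite cIm_conj.
Qed.

Lemma eq_cintegral f g : (forall x, D x -> f x = g x) ->
  cintegral mu D f = cintegral mu D g.
Proof.
move=> fg; rewrite /cintegral; congr (_ +i* _)%C;
  by apply: eq_Rintegral => x /set_mem Dx; rewrite fg.
Qed.

Lemma cintegrableD f g : cintegrable f -> cintegrable g ->
  cintegrable (fun x => f x + g x).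
Proof.
move=> [f1 f2] [g1 g2]; split.
  under [X in mu.-integrable _ X]eq_fun do rewrite /= cReD; exact: RintD.
under [X in mu.-integrable _ X]eq_fun do rewrite /= cImD; exact: RintD.
Qed.

Lemma cintegrableZ (c : R[i]) f : cintegrable f -> cintegrable (fun x => c * f x).
Proof.
move=> [f1 f2]; split.
  under [X in mu.-integrable _ X]eq_fun do rewrite /= cReM.
  by apply: RintB => //; exact: RintZ.
under [X in mu.-integrable _ X]eq_fun do rewrite /= cImM.
by apply: RintD => //; exact: RintZ.
Qed.

Lemma cintegrable_sum (I : Type) (s : seq I) (h : I -> T -> R[i]) :
  (forall i, cintegrable (h i)) -> cintegrable (fun x => \sum_(i <- s) h i x).
Proof.
move=> hi; split.
  under [X in mu.-integrable _ X]eq_fun do rewrite /= cRe_sum.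
  by apply: Rint_sum => // i; case: (hi i).
under [X in mu.-integrable _ X]eq_fun do rewrite /= cIm_sum.
by apply: Rint_sum => // i; case: (hi i).
Qed.

Lemma cintegralD f g : cintegrable f -> cintegrable g ->
  cintegral mu D (fun x => f x + g x) = cintegral mu D f + cintegral mu D g.
Proof.
move=> [f1 f2] [g1 g2]; rewrite /cintegral; congr (_ +i* _)%C.
  by rewrite -RintegralD//; apply: eq_Rintegral => x _; rewrite cReD.
by rewrite -RintegralD//; apply: eq_Rintegral => x _; rewrite cImD.
Qed.

Lemma cintegralZ (c : R[i]) f : cintegrable f ->
  cintegral mu D (fun x => c * f x) = c * cintegral mu D f.
Proof.
move=> [f1 f2]; rewrite /cintegral; case: c => x y; rewrite -[RHS]/(_ +i* _)%C.
congr (_ +i* _)%C.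
  rewrite -!RintegralZl// -RintegralB//; try exact: RintZ.
  by apply: eq_Rintegral => t _; rewrite cReM.
rewrite -!RintegralZl// -RintegralD//; try exact: RintZ.
by apply: eq_Rintegral => t _; rewrite cImM.
Qed.

Lemma cintegralB f g : cintegrable f -> cintegrable g ->
  cintegral mu D (fun x => f x - g x) = cintegral mu D f - cintegral mu D g.
Proof.
move=> fi gi; rewrite -mulN1r -cintegralZ// -cintegralD//; last exact: cintegrableZ.
by apply: eq_cintegral => x _; rewrite mulN1r.
Qed.

Lemma cmeasurable_funM f g : cmeasurable_fun D f -> cmeasurable_fun D g ->
  cmeasurable_fun D (fun x => f x * g x).
Proof.
move=> [f1 f2] [g1 g2]; split.
  under eq_fun do rewrite cReM.
  by apply: measurable_funB; exact: measurable_funM.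
under eq_fun do rewrite cImM.
by apply: measurable_funD; exact: measurable_funM.
Qed.

Lemma cmeasurable_funD f g : cmeasurable_fun D f -> cmeasurable_fun D g ->
  cmeasurable_fun D (fun x => f x + g x).
Proof.
move=> [f1 f2] [g1 g2]; split.
  by under eq_fun do rewrite cReD; exact: measurable_funD.
by under eq_fun do rewrite cImD; exact: measurable_funD.
Qed.

Lemma cmeasurable_fun_sqr_normc f : cmeasurable_fun D f ->
  measurable_fun D (fun x => normc (f x) ^+ 2).
Proof.
move=> [f1 f2]; under eq_fun do rewrite sqr_normcE.
by apply: measurable_funD; exact: measurable_funX.
Qed.

Lemma inL2_integrable f : inL2 mu D f -> Int (fun x => normc (f x) ^+ 2).
Proof.
move=> [mf fi]; apply/integrableP; split.
  exact/measurable_EFinP/cmeasurable_fun_sqr_normc.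
apply: le_lt_trans fi; rewrite /sqr_integral le_eqVlt; apply/orP; left.
by apply/eqP/eq_integral => x _ /=; rewrite ger0_norm// sqr_ge0.
Qed.

Lemma integrable_inL2 f : cmeasurable_fun D f ->
  Int (fun x => normc (f x) ^+ 2) -> inL2 mu D f.
Proof.
move=> mf /integrableP[_ fi]; split => //.
apply: le_lt_trans fi; rewrite /sqr_integral le_eqVlt; apply/orP; left.
by apply/eqP/eq_integral => x _ /=; rewrite ger0_norm// sqr_ge0.
Qed.

Lemma sqr_L2norm f : L2norm mu D f ^+ 2 = \int[mu]_(x in D) (normc (f x) ^+ 2).
Proof.
rewrite /L2norm sqr_sqrtr//; apply: fine_ge0; apply: integral_ge0 => x _.
by rewrite lee_fin sqr_ge0.
Qed.

Lemma inL2_conj f : inL2 mu D f -> inL2 mu D (fun x => conjc (f x)).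
Proof.
move=> [[f1 f2] fi]; split; last first.
  apply: le_lt_trans fi; rewrite /sqr_integral le_eqVlt; apply/orP; left.
  by apply/eqP/eq_integral => x _ /=; rewrite normc_conj.
split; first by under eq_fun do rewrite cRe_conj.
by under eq_fun do rewrite cIm_conj; exact: measurable_funN.
Qed.

Lemma L2norm_conj f : L2norm mu D (fun x => conjc (f x)) = L2norm mu D f.
Proof.
by congr (Num.sqrt (fine _)); apply: eq_integral => x _; rewrite normc_conj.
Qed.

Lemma inL2Z (c : R[i]) f : inL2 mu D f -> inL2 mu D (fun x => c * f x).
Proof.
move=> L2f; have [[f1 f2] _] := L2f; apply: integrable_inL2.
  split.
    under eq_fun do rewrite cReM.
    by apply: measurable_funB; apply: measurable_funM.
  under eq_fun do rewrite cImM.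
  by apply: measurable_funD; apply: measurable_funM.
under [X in mu.-integrable _ X]eq_fun do rewrite /= normcM exprMn.
by apply: RintZ => //; exact: inL2_integrable.
Qed.

Lemma L2normZ (c : R[i]) f : inL2 mu D f ->
  L2norm mu D (fun x => c * f x) ^+ 2 = normc c ^+ 2 * L2norm mu D f ^+ 2.
Proof.
move=> L2f; rewrite !sqr_L2norm -RintegralZl//; last exact: inL2_integrable.
by apply: eq_Rintegral => x _; rewrite normcM exprMn.
Qed.

Lemma inL2B f g : inL2 mu D f -> inL2 mu D g -> inL2 mu D (fun x => f x - g x).
Proof.
move=> L2f L2g; have [mf _] := L2f; have [mg _] := inL2Z (-1) L2g.
have mfg : cmeasurable_fun D (fun x => f x - g x).
  rewrite (_ : (fun _ => _) = fun x => f x + -1 * g x); first exact: cmeasurable_funD.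
  by apply: funext => x; rewrite mulN1r.
apply: integrable_inL2 => //.
have i2 : Int (fun x => 2 * normc (f x) ^+ 2 + 2 * normc (g x) ^+ 2).
  by apply: RintD => //; apply: RintZ => //; exact: inL2_integrable.
apply: ae_le_integrable i2 _ => //; first exact: cmeasurable_fun_sqr_normc.
apply: aeW => x _; rewrite ger0_norm ?sqr_ge0// !sqr_normcE !(cReD, cReN, cImD, cImN).
have := sqr_ge0 (complex.Re (f x) + complex.Re (g x)).
by have := sqr_ge0 (complex.Im (f x) + complex.Im (g x)); rewrite !expr2; nra.
Qed.

Lemma inL2D f g : inL2 mu D f -> inL2 mu D g -> inL2 mu D (fun x => f x + g x).
Proof.
move=> L2f /(inL2Z (-1)) /(inL2B L2f).
by under eq_fun do rewrite mulN1r opprK.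
Qed.

Lemma cintegrable_le f k : cmeasurable_fun D f -> Int k ->
  {ae mu, forall x, D x -> normc (f x) <= k x} -> cintegrable f.
Proof.
move=> [f1 f2] ki fk; split; apply: ae_le_integrable ki _ => //;
  apply: filterS fk => x + Dx => /(_ Dx); apply: le_trans.
  exact: normr_Re_le.
exact: normr_Im_le.
Qed.

(** The product is dominated by [L] times the sum of the squared moduli of [f] and [g]. *)
Lemma cintegrable_boundedM h f g (L : R) : measurable_fun D h ->
  {ae mu, forall x, D x -> `|h x| <= L} -> inL2 mu D f -> inL2 mu D g ->
  cintegrable (fun x => (h x)%:C%C * f x * g x).
Proof.
move=> mh hL L2f L2g.
have ki : Int (fun x => L * (normc (f x) ^+ 2 + normc (g x) ^+ 2)).
  by apply: RintZ => //; apply: RintD => //; exact: inL2_integrable.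
apply: cintegrable_le ki _.
  apply: cmeasurable_funM; last by case: L2g.
  by apply: cmeasurable_funM; [split => //=; exact: measurable_cst|case: L2f].
apply: filterS hL => x + Dx => /(_ Dx) hL; rewrite !normcM -mulrA.
apply: ler_pM; rewrite ?mulr_ge0 ?normc_ge0//=.
  by rewrite expr0n/= addr0 sqrtr_sqr.
have := sqr_ge0 (normc (f x) - normc (g x)).
have := sqr_ge0 (normc (f x) + normc (g x)); rewrite !expr2; nra.
Qed.

Lemma cintegrableM f g : inL2 mu D f -> inL2 mu D g ->
  cintegrable (fun x => f x * g x).
Proof.
move=> L2f L2g.
have -> : (fun x => f x * g x) = (fun x => (cst 1 x)%:C%C * f x * g x).
  by apply: funext => x; rewrite mul1r.
apply: (@cintegrable_boundedM _ _ _ 1) => //.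
by apply: aeW => x _; rewrite normr1.
Qed.

End complex_integrals.

(** * Estimates at a fixed frequency *)

Section fixed_frequency.
Context d (T : measurableType d) (R : realType) (mu : {measure set T -> \bar R}).
Context (Om B : set T) (mOm : measurable Om) (mB : measurable B) (BOm : B `<=` Om).
Context (n : nat) (gamma : T -> 'M[R]_n) (gamma0 : T -> R).
Context (L L0 C m C' : R).
Hypotheses (C_gt0 : 0 < C) (m_gt0 : 0 < m) (C'_gt0 : 0 < C') (L_ge0 : 0 <= L).
Hypothesis gamma_meas : forall i j, measurable_fun Om (fun x => gamma x i j).
Hypothesis gamma_bound : forall i j, {ae mu, forall x, Om x -> `|gamma x i j| <= L0}.
Hypothesis gamma0_meas : measurable_fun Om gamma0.
Hypothesis gamma0_bound : forall x, Om x -> `|gamma0 x| <= L0.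

(** The almost-everywhere conditions on the coefficients in one predicate, so that a single null set
    is discarded in each integration. *)
Definition admissible x := [/\ (gamma x)^T = gamma x,
  forall i j, `|(gamma x - (gamma0 x)%:M) i j| <= L,
  forall p, C * sqn p <= bil (gamma x) p p,
  ~ B x -> gamma x = (gamma0 x)%:M & m <= gamma0 x].

Hypothesis gamma_adm : {ae mu, forall x, Om x -> admissible x}.
Hypothesis gamma_jump :
  {ae mu, forall x, B x -> forall p, C' * sqn p <= - bil (gamma x - (gamma0 x)%:M) p p} \/
  {ae mu, forall x, B x -> forall p, C' * sqn p <= bil (gamma x - (gamma0 x)%:M) p p}.

Local Notation Int f := (mu.-integrable Om (EFin \o f)).

Lemma cintegrable_cdot (A : T -> 'M[R]_n) (K : R) (a b : 'I_n -> T -> R[i]) :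
  (forall i j, measurable_fun Om (fun x => A x i j)) ->
  (forall i j, {ae mu, forall x, Om x -> `|A x i j| <= K}) ->
  (forall i, inL2 mu Om (a i)) -> (forall i, inL2 mu Om (b i)) ->
  cintegrable mu Om (fun x => cdot (A x) (a^~ x) (b^~ x)).
Proof.
move=> mA bA La Lb; apply: cintegrable_sum => // i; apply: cintegrable_sum => // j.
exact: (cintegrable_boundedM mOm (mA i j) (bA i j)).
Qed.

Lemma cintegrable_green (A : T -> 'M[R]_n) (K : R) (a b : 'I_n -> T -> R[i])
    (f h : T -> R[i]) :
  (forall i j, measurable_fun Om (fun x => A x i j)) ->
  (forall i j, {ae mu, forall x, Om x -> `|A x i j| <= K}) ->
  (forall i, inL2 mu Om (a i)) -> (forall i, inL2 mu Om (b i)) ->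
  inL2 mu Om f -> inL2 mu Om h ->
  cintegrable mu Om (fun x => cdot (A x) (a^~ x) (b^~ x) + f x * h x).
Proof.
move=> mA bA La Lb Lf Lh; apply: (cintegrableD mOm); last exact: cintegrableM.
exact: cintegrable_cdot mA bA La Lb.
Qed.

Lemma scalar_mx_meas i j : measurable_fun Om (fun x => ((gamma0 x)%:M : 'M[R]_n) i j).
Proof.
under eq_fun do rewrite mxE.
by case: (i == j) => //=; exact: measurable_cst.
Qed.

Lemma scalar_mx_bound i j :
  {ae mu, forall x, Om x -> `|((gamma0 x)%:M : 'M[R]_n) i j| <= L0}.
Proof.
apply: aeW => x /gamma0_bound; rewrite mxE; case: (i == j) => //=.
by rewrite normr0; apply: le_trans.
Qed.

Context (u w F : T -> R[i]) (Gu Gw : 'I_n -> T -> R[i]) (tau s : R).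
Hypotheses (tau_gt0 : 0 < tau) (s_gt0 : 0 < s).
Hypotheses (L2u : inL2 mu Om u) (L2w : inL2 mu Om w) (L2F : inL2 mu Om F).
Hypotheses (L2Gu : forall i, inL2 mu Om (Gu i)) (L2Gw : forall i, inL2 mu Om (Gw i)).

Local Notation cj a := (fun i => conjc (a i)).
Local Notation tc := (tau%:C%C).

Let f1 x := cdot (gamma x) (Gw^~ x) (cj (Gu^~ x)) + (tc * w x + F x) * conjc (u x).
Let f2 x := cdot (gamma0 x)%:M (Gu^~ x) (cj (Gu^~ x)) + tc * u x * conjc (u x).
Let f3 x := cdot (gamma x) (Gw^~ x) (cj (Gw^~ x)) + (tc * w x + F x) * conjc (w x).
Let f4 x := cdot (gamma0 x)%:M (Gu^~ x) (cj (Gw^~ x)) + tc * u x * conjc (w x).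
Let f5 x := cdot (gamma0 x)%:M (cj (Gu^~ x)) (Gw^~ x) + tc * conjc (u x) * w x.

(** w and u have the same conormal derivative, so their Green's formulas agree for the test
    functions conj u and conj w. *)
Hypothesis eq12 : cintegral mu Om f1 = cintegral mu Om f2.
Hypothesis eq34 : cintegral mu Om f3 = cintegral mu Om f4.

Let L2cj (a : 'I_n -> T -> R[i]) : (forall i, inL2 mu Om (a i)) ->
  forall i, inL2 mu Om (fun x => conjc (a i x)).
Proof. by move=> La i; exact: inL2_conj. Qed.

Let L2tw : inL2 mu Om (fun x => tc * w x + F x).
Proof. by apply: inL2D => //; exact: inL2Z. Qed.

Let i1 : cintegrable mu Om f1.
Proof.
exact: (cintegrable_green gamma_meas gamma_bound L2Gw (L2cj L2Gu) L2tw (inL2_conj L2u)).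
Qed.

Let i2 : cintegrable mu Om f2.
Proof.
exact: (cintegrable_green scalar_mx_meas scalar_mx_bound L2Gu (L2cj L2Gu)
  (inL2Z mOm _ L2u) (inL2_conj L2u)).
Qed.

Let i3 : cintegrable mu Om f3.
Proof.
exact: (cintegrable_green gamma_meas gamma_bound L2Gw (L2cj L2Gw) L2tw (inL2_conj L2w)).
Qed.

Let i4 : cintegrable mu Om f4.
Proof.
exact: (cintegrable_green scalar_mx_meas scalar_mx_bound L2Gu (L2cj L2Gw)
  (inL2Z mOm _ L2u) (inL2_conj L2w)).
Qed.

Let i5 : cintegrable mu Om f5.
Proof.
exact: (cintegrable_green scalar_mx_meas scalar_mx_bound (L2cj L2Gu) L2Gw
  (inL2Z mOm _ (inL2_conj L2u)) L2w).
Qed.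

Let ri1 : Int (fun x => complex.Re (f1 x)). Proof. by case: i1. Qed.
Let ri2 : Int (fun x => complex.Re (f2 x)). Proof. by case: i2. Qed.
Let ri3 : Int (fun x => complex.Re (f3 x)). Proof. by case: i3. Qed.
Let ri4 : Int (fun x => complex.Re (f4 x)). Proof. by case: i4. Qed.

Let r f := \int[mu]_(x in Om) complex.Re (f x).

Let r12 : r f1 = r f2. Proof. by case: eq12. Qed.
Let r34 : r f3 = r f4. Proof. by case: eq34. Qed.
(** [f5] is the complex conjugate of [f4], because [gamma0] and [tau] are real. *)
Let r45 : r f4 = r f5.
Proof.
apply: eq_Rintegral => x _; rewrite /f4 /f5 !cReD !Re_cdot !rp_conj !ip_conj bilNr bilNl.
rewrite (@bil_sym _ _ _ (fun i => complex.Re (Gu i x))) ?tr_scalar_mx//.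
rewrite (@bil_sym _ _ _ (fun i => complex.Im (Gu i x))) ?tr_scalar_mx//.
by rewrite !(cReM, cImM, cRe_conj, cIm_conj)/=; ring.
Qed.

Definition grad_energy : R := \sum_i L2norm mu B (Gu i) ^+ 2.
Local Notation X := grad_energy.
Local Notation Fn := (L2norm mu Om F ^+ 2).
Local Notation V := (L2norm mu Om u ^+ 2).
Let Y : R := \sum_i L2norm mu Om (fun x => Gw i x - Gu i x) ^+ 2.
Local Notation ind x := (`[< B x >] : bool)%:R.

Let gu x := ind x * csqn (Gu^~ x).

Let gu_restrict : gu = (fun x => csqn (Gu^~ x)) \_ B.
Proof.
apply: funext => x; rewrite /gu /patch; case: asboolP => Bx.
  by rewrite mul1r ifT// inE.
by rewrite mul0r ifF//; apply/negP; rewrite inE.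
Qed.

Let csqn_int : Int (fun x => csqn (Gu^~ x)).
Proof. by apply: Rint_sum => // i; exact: inL2_integrable. Qed.

Let gu_int : Int gu.
Proof.
rewrite gu_restrict -restrict_EFin; apply/integrable_restrict => //.
by apply: integrableS csqn_int => //; exact: measurableI.
Qed.

Let gu_integral : \int[mu]_(x in Om) gu x = X.
Proof.
rewrite gu_restrict -Rintegral_mkcondr (setIidr BOm) Rintegral_sum//; last first.
  move=> i; apply: (@integrableS _ _ _ mu Om) => //; exact: inL2_integrable.
by apply: eq_bigr => i _; rewrite sqr_L2norm.
Qed.

Let gd_int : Int (fun x => csqn (fun i => Gw i x - Gu i x)).
Proof. by apply: Rint_sum => // i; apply: inL2_integrable => //; exact: inL2B. Qed.

Let gd_integral : \int[mu]_(x in Om) csqn (fun i => Gw i x - Gu i x) = Y.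
Proof.
rewrite Rintegral_sum//; last first.
  by move=> i; apply: inL2_integrable => //; exact: inL2B.
by apply: eq_bigr => i _; rewrite sqr_L2norm.
Qed.

(** The common shape of all pointwise bounds, so that their integrals are computed once. *)
Let comb (a b c e : R) x := a * gu x + b * csqn (fun i => Gw i x - Gu i x)
  + (c * normc (F x) ^+ 2 + e * normc (u x) ^+ 2).

Let comb_int a b c e : Int (comb a b c e).
Proof.
by apply: RintD => //; apply: RintD => //; apply: RintZ => //; exact: inL2_integrable.
Qed.

Let comb_integral a b c e :
  \int[mu]_(x in Om) comb a b c e x = a * X + b * Y + (c * Fn + e * V).
Proof.
have FI := inL2_integrable L2F; have uI := inL2_integrable L2u.
rewrite /comb RintegralD//; [|apply: RintD => //; exact: RintZ..].
by rewrite !RintegralD ?RintegralZl ?gu_integral ?gd_integral ?sqr_L2norm//; exact: RintZ.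
Qed.

Let J := cintegral mu Om f1 - cintegral mu Om f5.

Let ReJ : complex.Re J = r f1 - r f5. Proof. by rewrite /J cReD cReN. Qed.

Let adm_outP x : admissible x -> ~~ `[< B x >] -> gamma x = (gamma0 x)%:M.
Proof. by case=> _ _ _ + _ => h /asboolPn /h. Qed.

(** By [r12], [r34] and [r45], [- Re J] is the integral of the combination bounded in
    [pointwise_A1]. *)
Let lower_A1 :
  {ae mu, forall x, B x -> forall p, C' * sqn p <= - bil (gamma x - (gamma0 x)%:M) p p} ->
  C' * X - ((tau^-1 + s) * Fn + V / s) <= - complex.Re J.
Proof.
move=> A1.
have h2 := RintD mOm ri3 ri2; have h1 := RintZ mOm 2 ri1.
have -> : - complex.Re J = \int[mu]_(x in Om)
    (complex.Re (f3 x) + complex.Re (f2 x) - 2 * complex.Re (f1 x)).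
  rewrite RintegralB// RintegralD// RintegralZl//.
  by rewrite ReJ -/(r f1) -/(r f2) -/(r f3); have := r12; have := r34; have := r45; lra.
have -> : C' * X - ((tau^-1 + s) * Fn + V / s) =
    \int[mu]_(x in Om) comb C' 0 (- (tau^-1 + s)) (- s^-1) x.
  by rewrite comb_integral; ring.
apply: ae_le_Rintegral => //.
- exact: RintB.
- apply: filterS2 A1 gamma_adm => x A1x + Omx => /(_ Omx) adm.
  have [sym bd ell out mg] := adm.
  apply: le_trans (pointwise_A1 (d := `[< B x >]) (C := C) (C' := C') sym C_gt0 ell
    (adm_outP adm) _ _ _ _ _ tau_gt0 s_gt0 _).
    by rewrite /comb /gu le_eqVlt; apply/orP; left; apply/eqP; ring.
  by move=> /asboolP; exact: A1x.
Qed.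

Let lower_A2 :
  {ae mu, forall x, B x -> forall p, C' * sqn p <= bil (gamma x - (gamma0 x)%:M) p p} ->
  Num.min m C' / 2 * X - ((tau^-1 + s) * Fn + V / s) <= complex.Re J.
Proof.
move=> A2.
have h2 := RintD mOm ri2 ri3; have h1 := RintZ mOm 2 ri4.
have -> : complex.Re J = \int[mu]_(x in Om)
    (complex.Re (f2 x) + complex.Re (f3 x) - 2 * complex.Re (f4 x)).
  rewrite RintegralB// RintegralD// RintegralZl//.
  by rewrite ReJ -/(r f4) -/(r f2) -/(r f3); have := r12; have := r34; have := r45; lra.
have -> : Num.min m C' / 2 * X - ((tau^-1 + s) * Fn + V / s) =
    \int[mu]_(x in Om) comb (Num.min m C' / 2) 0 (- (tau^-1 + s)) (- s^-1) x.
  by rewrite comb_integral; ring.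
apply: ae_le_Rintegral => //.
- exact: RintB.
- apply: filterS2 A2 gamma_adm => x A2x + Omx => /(_ Omx) adm.
  have [sym bd ell out mg] := adm.
  apply: le_trans (pointwise_A2 (d := `[< B x >]) (m := m) (C' := C')
    (adm_outP adm) m_gt0 mg C'_gt0 _ _ _ _ _ tau_gt0 s_gt0 _).
    by rewrite /comb /gu le_eqVlt; apply/orP; left; apply/eqP; ring.
  by move=> /asboolP; exact: A2x.
Qed.

Lemma indicator_lower : Num.min m C' / 2 * X - ((tau^-1 + s) * Fn + V / s) <= normc J.
Proof.
have X0 : 0 <= X by apply: sumr_ge0 => i _; rewrite sqr_ge0.
apply: le_trans (normr_Re_le J).
case: gamma_jump => [/lower_A1|/lower_A2] low.
- rewrite -normrN; apply: le_trans (ler_norm _); apply: le_trans low.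
  rewrite lerD2r ler_wpM2r// ler_pdivrMr//.
  have : Num.min m C' <= C' by rewrite ge_min lexx orbT.
  by have := C'_gt0; lra.
- exact: le_trans low (ler_norm _).
Qed.

Let K1 := L * n%:R * cross_weight n L C.

(** The integral of the combination in [pointwise_energy] is zero by [r12] and [r34]. *)
Let energy : C / 2 * Y <= K1 * X + Fn / tau.
Proof.
have h34 := RintB mOm ri3 ri4; have h341 := RintB mOm h34 ri1.
suff : K1 * - X + C / 2 * Y - Fn / tau <= 0 by lra.
have {1}<- : \int[mu]_(x in Om) (complex.Re (f3 x) - complex.Re (f4 x)
    - complex.Re (f1 x) + complex.Re (f2 x)) = 0.
  rewrite RintegralD// 2?RintegralB//.
  by rewrite -/(r f1) -/(r f2) -/(r f3) -/(r f4) r12 r34; ring.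
have -> : K1 * - X + C / 2 * Y - Fn / tau =
    \int[mu]_(x in Om) comb (- K1) (C / 2) (- tau^-1) 0 x.
  by rewrite comb_integral; ring.
apply: ae_le_Rintegral => //.
- exact: RintD.
- apply: filterS gamma_adm => x + Omx => /(_ Omx) adm.
  have [sym bd ell out mg] := adm.
  apply: le_trans (pointwise_energy (d := `[< B x >]) (C := C) L_ge0 C_gt0 bd ell
    (adm_outP adm) _ _ _ _ _ tau_gt0).
  by rewrite /comb /gu le_eqVlt; apply/orP; left; apply/eqP; rewrite /K1; ring.
Qed.

Let upper g : Int g ->
  {ae mu, forall x, Om x -> `|g x| <= comb (3 * (L * n%:R)) (2 * (L * n%:R)) s s^-1 x} ->
  `|\int[mu]_(x in Om) g x| <=
  3 * (L * n%:R) * X + 2 * (L * n%:R) * Y + (s * Fn + s^-1 * V).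
Proof.
move=> gi gb; rewrite -comb_integral ler_norml -[X in - X <= _]opprK lerNl opprK.
rewrite -Rintegral_opp; apply/andP; split; apply: ae_le_Rintegral => //.
- exact: RintN.
- apply: filterS gb => x + Omx => /(_ Omx); apply: le_trans.
  by rewrite -normrN ler_norm.
- by apply: filterS gb => x + Omx => /(_ Omx); apply: le_trans; rewrite ler_norm.
Qed.

(** With N = [L * n%:R] and K1 = N times [cross_weight]: adding the bounds of [Re J] and [Im J]
    gives 6 N X + 4 N Y + 2 (s Fn + V / s), and [energy] bounds Y by 2 / C (K1 X + Fn / tau). The
    summands are the resulting coefficients of X, of Fn / tau, and of the rest. *)
Definition upper_const : R :=
  2 * (L * n%:R) * (3 + 4 * (L * n%:R * cross_weight n L C) / C) + 8 * (L * n%:R) / C + 2.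

Lemma upper_const_ge2 : 2 <= upper_const.
Proof.
have N0 : 0 <= L * n%:R by rewrite mulr_ge0.
have C0 := ltW C_gt0; have K0 := ltW (cross_weight_gt0 n L_ge0 C_gt0).
rewrite /upper_const lerDr addr_ge0// ?divr_ge0// ?mulr_ge0//.
by rewrite addr_ge0// divr_ge0// !mulr_ge0.
Qed.

Lemma indicator_upper :
  normc J <= upper_const * X + upper_const * ((tau^-1 + s) * Fn + V / s).
Proof.
have i15 : cintegrable mu Om (fun x => f1 x - f5 x).
  apply: cintegrableD => //.
  by under [X in cintegrable _ _ X]eq_fun do rewrite -mulN1r; exact: cintegrableZ.
have JE : J = cintegral mu Om (fun x => f1 x - f5 x) by rewrite cintegralB.
have bound x : comb (3 * (L * n%:R)) (2 * (L * n%:R)) s s^-1 x =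
    L * n%:R * (3 * (ind x * csqn (Gu^~ x))
   + 2 * csqn (fun i => Gw i x - Gu i x)) + (s * normc (F x) ^+ 2 + normc (u x) ^+ 2 / s).
  by rewrite /comb /gu; ring.
have ReB : `|complex.Re J| <=
    3 * (L * n%:R) * X + 2 * (L * n%:R) * Y + (s * Fn + s^-1 * V).
  rewrite JE; apply: upper; first by case: i15.
  apply: filterS gamma_adm => x + Omx => /(_ Omx) adm.
  have [sym bd ell out mg] := adm; rewrite bound.
  exact: (pointwise_upper_Re (d := `[< B x >]) L_ge0 bd (adm_outP adm)).
have ImB : `|complex.Im J| <=
    3 * (L * n%:R) * X + 2 * (L * n%:R) * Y + (s * Fn + s^-1 * V).
  rewrite JE; apply: upper; first by case: i15.
  apply: filterS gamma_adm => x + Omx => /(_ Omx) adm.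
  have [sym bd ell out mg] := adm; rewrite bound.
  exact: (pointwise_upper_Im (d := `[< B x >]) L_ge0 bd (adm_outP adm)).
apply: le_trans (normc_le J) _.
have X0 : 0 <= X by apply: sumr_ge0 => i _; rewrite sqr_ge0.
have N0 : 0 <= L * n%:R by rewrite mulr_ge0.
have K10 : 0 <= K1 by rewrite /K1 mulr_ge0// ltW// cross_weight_gt0.
have Yb : Y <= 2 / C * (K1 * X + Fn / tau).
  by rewrite -[2 / C]invf_div ler_pdivlMl ?divr_gt0//; exact: energy.
have {Yb} NY := ler_wpM2l N0 Yb.
pose a := 2 * (L * n%:R) * (3 + 4 * K1 / C); pose b := 8 * (L * n%:R) / C.
have UE : upper_const = a + b + 2 by [].
have C0 : 0 <= C^-1 by rewrite invr_ge0 ltW.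
have a0 : 0 <= a by rewrite mulr_ge0 ?mulr_ge0// addr_ge0// mulr_ge0// mulr_ge0.
have b0 : 0 <= b by rewrite !mulr_ge0.
have T0 : 0 <= Fn / tau by rewrite mulr_ge0 ?sqr_ge0// invr_ge0 ltW.
have S0 : 0 <= s * Fn by rewrite mulr_ge0 ?sqr_ge0// ltW.
have V0 : 0 <= V / s by rewrite mulr_ge0 ?sqr_ge0// invr_ge0 ltW.
(* These products are the surplus created by using one constant in front of all terms; [lra] needs
   them as hypotheses. *)
have p1 := mulr_ge0 (addr_ge0 b0 (ler0n R 2)) X0.
have p2 := mulr_ge0 (addr_ge0 a0 (ler0n R 2)) T0.
have p3 := mulr_ge0 (addr_ge0 a0 b0) S0.
have p4 := mulr_ge0 (addr_ge0 a0 b0) V0.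
have aX : a * X = 6 * (L * n%:R) * X + 4 * (L * n%:R * (2 / C * (K1 * X))).
  by rewrite /a; ring.
have bT : b * (Fn / tau) = 4 * (L * n%:R * (2 / C * (Fn / tau))) by rewrite /b; ring.
rewrite UE; lra.
Qed.

End fixed_frequency.

(** * Conormal derivatives and traces *)

Section conjugation.
Context (R : realType) (n : nat).
Implicit Types (Omega : set 'rV[R]_n) (u h : 'rV[R]_n -> R[i]).
Implicit Types (G : 'I_n -> 'rV[R]_n -> R[i]) (f : 'rV[R]_n -> R).

Lemma Ck_opp k f : Ck k setT f -> Ck k setT (fun x => - f x).
Proof.
elim: k f => [|k ih] f [cf df]; split.
- by move=> x _; apply: continuousN; exact: cf.
- by [].
- by move=> x _; apply: continuousN; exact: cf.
move=> i; have [dfi Cf] := df i; split.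
  by move=> x _; apply: derivableN; exact: dfi.
rewrite (_ : partial i _ = fun x => - partial i f x); first exact: ih.
by apply: funext => x; rewrite /partial; apply: deriveN; exact: dfi.
Qed.

Lemma csmooth_conj u : csmooth u -> csmooth (fun x => conjc (u x)).
Proof.
move=> [su1 su2]; split => k.
  by under eq_fun do rewrite cRe_conj; exact: su1.
by under eq_fun do rewrite cIm_conj; apply: Ck_opp; exact: su2.
Qed.

Lemma cpartial_conj u i : csmooth u ->
  cpartial i (fun x => conjc (u x)) = fun x => conjc (cpartial i u x).
Proof.
move=> [_ su2]; apply: funext => x; rewrite /cpartial /=; congr (_ +i* _)%C.
  by congr (partial i _ x); apply: funext => y; rewrite cRe_conj.
under [X in partial i X]eq_fun do rewrite cIm_conj.
by apply: deriveN; have [_ /(_ i)[+ _]] := su2 1%N; exact.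
Qed.

(** Test functions are real, so conjugating the weak-derivative identity for [u] gives the one for
    its conjugate. *)
Lemma inH1_conj Omega u G : inH1 Omega u G ->
  inH1 Omega (fun x => conjc (u x)) (fun i x => conjc (G i x)).
Proof.
move=> [L2u L2G wk]; split; [exact: inL2_conj|by move=> i; exact: inL2_conj|].
move=> i phi tphi.
have conjE (f : 'rV[R]_n -> R[i]) (p : 'rV[R]_n -> R) :
    (fun x => conjc (f x) * (p x)%:C%C) = (fun x => conjc (f x * (p x)%:C%C)).
  by apply: funext => x; rewrite rmorphM /= oppr0.
by rewrite (conjE u) (conjE (G i)) !cintegral_conj wk// rmorphN.
Qed.

Lemma cvgL2_conj d (T : measurableType d) (mu : {measure set T -> \bar R})
    (D : set T) (f_ : nat -> T -> R[i]) (f : T -> R[i]) :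
  cvgL2 mu D f_ f ->
  cvgL2 mu D (fun k x => conjc (f_ k x)) (fun x => conjc (f x)).
Proof.
move=> [L2f_ L2f cf]; split.
- by move=> k; exact: inL2_conj.
- exact: inL2_conj.
- rewrite (_ : (fun k => _) = fun k => L2norm mu D (fun x => f_ k x - f x))//.
  apply: funext => k; rewrite -[RHS]L2norm_conj; congr L2norm.
  by apply: funext => x; rewrite rmorphB.
Qed.

(** Conjugate the approximating sequence. *)
Lemma is_trace_conj Omega u G h : is_trace Omega u G h ->
  is_trace Omega (fun x => conjc (u x)) (fun i x => conjc (G i x))
    (fun x => conjc (h x)).
Proof.
move=> [phi [sphi cu cG ch]]; exists (fun k x => conjc (phi k x)); split.
- by move=> k; exact: csmooth_conj.
- exact: cvgL2_conj.
- move=> i; rewrite (_ : (fun k => _) = fun k x => conjc (cpartial i (phi k) x)).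
    exact: cvgL2_conj.
  by apply: funext => k; rewrite cpartial_conj.
- exact: cvgL2_conj.
Qed.

End conjugation.

(** * Measurability and compactness in Euclidean space *)

Section domain.
Context (R : realType) (n : nat).
Implicit Types (A : set 'rV[R]_n) (f : 'rV[R]_n -> R).

Lemma open_rV_measurable A : open A -> measurable A.
Proof. by move=> oA; exact: sub_sigma_algebra. Qed.

Lemma continuous_rV_measurable f : continuous f -> measurable_fun setT f.
Proof.
move=> cf; apply: (measurability _ (RGenOInfty.measurableE R)).
move=> _ [_ [a ->] <-]; rewrite setTI; apply: sub_sigma_algebra => /=.
have: open `]a, +oo[%classic by exact: interval_open.
by apply: open_comp => x _; exact: cf.
Qed.

Lemma bounded_closure_compact A : bounded_set A -> compact (closure A).
Proof.
move=> bA; apply: bounded_closed_compact; last exact: closed_closure.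
move: bA => [M0 [M0r AM]]; exists M0; split => // M /AM {}AM.
have cM : closed [set x : 'rV[R]_n | `|x| <= M].
  exact: (closed_comp (fun x _ => @norm_continuous _ _ x) (@closed_le R M)).
suff : closure A `<=` [set x : 'rV[R]_n | `|x| <= M] by [].
by rewrite [X in _ `<=` X](closure_id _).1//; exact: closure_subset.
Qed.

End domain.

(** * Uniform constants from the standing assumptions *)

Section standing_bounds.
Context (R : realType) (n : nat).
Local Notation leb := (lebesgue_rV R n).
Context (Omega D : set 'rV[R]_n) (gamma : 'rV[R]_n -> 'M[R]_n) (gamma0 : 'rV[R]_n -> R).
Hypotheses (hOmega : bounded_smooth_domain Omega).
Hypotheses (hstand : standing_assumptions Omega D gamma gamma0).

Lemma domain_open : open Omega.
Proof. by case: hOmega. Qed.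

Lemma inclusion_sub : D `<=` Omega.
Proof. by apply: subset_trans (D_inside hstand); exact: subset_closure. Qed.

Let closure_compact : compact (closure Omega).
Proof. by case: hOmega => _ _ _ bO _; exact: bounded_closure_compact. Qed.

Let closure_neq0 : closure Omega !=set0.
Proof. by case: hOmega => _ _ [x Ox] _ _; exists x; exact: subset_closure. Qed.

Lemma gamma0_measurable : measurable_fun Omega gamma0.
Proof.
have [g sg eg] := gamma0_smooth hstand.
have cg : continuous g by move=> x; have [+ _] := sg 0%N; exact.
apply: (@eq_measurable_fun _ _ _ _ _ g).
  by move=> x /set_mem Ox; rewrite eg//; exact: subset_closure.
by apply: measurable_funS (continuous_rV_measurable cg).
Qed.

(** Extreme values of the smooth extension of gamma_0 on the compact closure of the domain. *)
Lemma gamma0_range : exists m M, 0 < m /\ forall x, Omega x -> m <= gamma0 x <= M.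
Proof.
have [g sg eg] := gamma0_smooth hstand.
have cg : continuous g by move=> x; have [+ _] := sg 0%N; exact.
have cgO : {within closure Omega, continuous g} by exact: continuous_subspaceT.
have [a /set_mem aO ha] := EVT_min_rV closure_neq0 closure_compact cgO.
have [b /set_mem bO hb] := EVT_max_rV closure_neq0 closure_compact cgO.
exists (g a), (g b); split; first by rewrite -eg//; exact: (gamma0_pos hstand).
move=> x /subset_closure xO; rewrite eg//.
by rewrite ha ?hb// inE.
Qed.

Lemma gamma_bounded :
  exists M, 0 <= M /\ forall i j, {ae leb, forall x, Omega x -> `|gamma x i j| <= M}.
Proof.
have /choice[f hf] : forall ij : 'I_n * 'I_n, exists M,
    {ae leb, forall x, Omega x -> `|gamma x ij.1 ij.2| <= M}.
  by move=> [i j]; have [_] := gamma_Linfty hstand i j.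
exists (\sum_ij `|f ij|); split; first by apply: sumr_ge0.
move=> i j; apply: filterS (hf (i, j)) => x + Ox => /(_ Ox) /= h.
apply: (le_trans h); rewrite (bigD1 (i, j))//=.
by apply: (le_trans (ler_norm _)); rewrite lerDl sumr_ge0.
Qed.

Lemma standing_bounds : exists L L0 C m C' : R,
  [/\ 0 < C, 0 < m, 0 < C', 0 <= L &
  [/\ forall i j, {ae leb, forall x, Omega x -> `|gamma x i j| <= L0},
      forall x, Omega x -> `|gamma0 x| <= L0,
      {ae leb, forall x, Omega x -> admissible D gamma gamma0 L C m x} &
      {ae leb, forall x, D x -> forall p,
         C' * sqn p <= - bil (gamma x - (gamma0 x)%:M) p p} \/
      {ae leb, forall x, D x -> forall p,
         C' * sqn p <= bil (gamma x - (gamma0 x)%:M) p p}]].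
Proof.
have [m [M0 [m0 hm]]] := gamma0_range; have [M [M_ge0 hM]] := gamma_bounded.
have [C C0 hC] := gamma_elliptic hstand.
have [C' C'0 hC'] : exists2 C' : R, 0 < C' &
    {ae leb, forall x, D x -> forall p,
       C' * sqn p <= - bil (gamma x - (gamma0 x)%:M) p p} \/
    {ae leb, forall x, D x -> forall p,
       C' * sqn p <= bil (gamma x - (gamma0 x)%:M) p p}.
  case: (gamma_jump hstand) => -[C' C'0 h]; exists C' => //; [left|right];
    by apply: filterS h => x + Dx p => /(_ Dx); rewrite bil_quad sqn_sqrnorm; exact.
have g0M x : Omega x -> `|gamma0 x| <= M + `|M0|.
  move=> /hm /andP[mg gM]; rewrite ger0_norm; last exact: le_trans (ltW m0) mg.
  by apply: (le_trans gM); have := ler_norm M0; lra.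
(* [L0 = M + |M0|] bounds gamma and gamma_0 alike; [L] adds the bounds of both, since it must
   control their difference. *)
exists (M + (M + `|M0|)), (M + `|M0|), C, m, C'; split => //.
  by rewrite !addr_ge0.
split => //.
- by move=> i j; apply: filterS (hM i j) => x + Ox => /(_ Ox) h; apply: (le_trans h); rewrite lerDl.
(* There are finitely many entries, so their exceptional sets merge into one null set. *)
- have hMall : {ae leb, forall x, forall ij : 'I_n * 'I_n,
      Omega x -> `|gamma x ij.1 ij.2| <= M}.
    by apply: filter_forall => -[i j]; exact: hM.
  apply: filterS (filterI hMall (filterI hC (filterI (gamma_sym hstand)
    (gamma_outside hstand)))) => x [bx [ex [sx ox]]] Ox; split.
  + exact: sx.
  + move=> i j; rewrite !mxE; apply: (le_trans (ler_normB _ _)); apply: lerD.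
      exact: bx (i, j) Ox.
    by case: (i == j); rewrite ?mulr1n ?mulr0n ?normr0 ?addr_ge0// g0M.
  + by move=> p; rewrite bil_quad sqn_sqrnorm; exact: ex.
  + by move=> nD; exact: ox.
  + by have /andP[] := hm _ Ox.
Qed.

End standing_bounds.

(** * Green's formula and the boundary integral at one frequency *)

Section indicator.
Context (R : realType) (n : nat).
Local Notation leb := (lebesgue_rV R n).
Implicit Types (Omega D : set 'rV[R]_n) (u : 'rV[R]_n -> R[i]).
Implicit Types (G : 'I_n -> 'rV[R]_n -> R[i]).

Lemma sqr_gradnorm D G : gradnorm D G ^+ 2 = \sum_i L2norm leb D (G i) ^+ 2.
Proof. by rewrite /gradnorm sqr_sqrtr// sumr_ge0// => i _; rewrite sqr_ge0. Qed.

Lemma L2norm_le_H1norm Omega u G : L2norm leb Omega u <= H1norm Omega u G.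
Proof.
rewrite /H1norm -[leLHS]ger0_norm ?sqrtr_ge0// -sqrtr_sqr ler_sqrt.
  by rewrite lerDl sqr_ge0.
by rewrite addr_ge0 ?sqr_ge0.
Qed.

Lemma gradnorm_le_H1norm Omega D u G : measurable Omega -> measurable D ->
  D `<=` Omega -> (forall i, inL2 leb Omega (G i)) ->
  gradnorm D G <= H1norm Omega u G.
Proof.
move=> mO mD DO L2G; rewrite /H1norm -[leLHS]ger0_norm ?sqrtr_ge0// -sqrtr_sqr.
rewrite ler_sqrt; last by rewrite addr_ge0 ?sqr_ge0.
apply: (@le_trans _ _ (gradnorm Omega G ^+ 2)); last by rewrite lerDr sqr_ge0.
rewrite !sqr_gradnorm; apply: ler_sum => i _.
have GO := inL2_integrable (L2G i).
have GD : leb.-integrable D (EFin \o (fun x => normc (G i x) ^+ 2)) by exact: integrableS GO.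
rewrite !sqr_L2norm; apply: fine_le; [exact: integrable_fin_num..|].
apply: ge0_subset_integral => //; first exact: measurable_int GO.
by move=> x _; rewrite lee_fin sqr_ge0.
Qed.

Context (Omega D : set 'rV[R]_n) (gamma : 'rV[R]_n -> 'M[R]_n) (gamma0 : 'rV[R]_n -> R).
Context (L L0 C m C' : R).
Hypotheses (mO : measurable Omega) (mD : measurable D) (DO : D `<=` Omega).
Hypotheses (C_gt0 : 0 < C) (m_gt0 : 0 < m) (C'_gt0 : 0 < C') (L_ge0 : 0 <= L).
Hypothesis gamma_meas : forall i j, measurable_fun Omega (fun x => gamma x i j).
Hypothesis gamma_bound :
  forall i j, {ae leb, forall x, Omega x -> `|gamma x i j| <= L0}.
Hypothesis gamma0_meas : measurable_fun Omega gamma0.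
Hypothesis gamma0_bound : forall x, Omega x -> `|gamma0 x| <= L0.
Hypothesis gamma_adm :
  {ae leb, forall x, Omega x -> admissible D gamma gamma0 L C m x}.
Hypothesis gamma_jump :
  {ae leb, forall x, D x -> forall p, C' * sqn p <= - bil (gamma x - (gamma0 x)%:M) p p} \/
  {ae leb, forall x, D x -> forall p, C' * sqn p <= bil (gamma x - (gamma0 x)%:M) p p}.

Context (v w F : 'rV[R]_n -> R[i]) (gradv gradw : 'I_n -> 'rV[R]_n -> R[i]).
Context (tau : R) (Psi q : R[i]) (dv dvbar g : ('rV[R]_n -> R[i]) -> R[i]).
Context (trvbar trw : 'rV[R]_n -> R[i]).
Hypotheses (tau_gt0 : 0 < tau) (L2F : inL2 leb Omega F).
Hypotheses (hv : inH1 Omega v gradv) (hw : inH1 Omega w gradw).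
Hypothesis hdv : is_conormal Omega (fun x => (gamma0 x)%:M) gradv
  (fun x => tau%:C%C * v x) dv.
Hypothesis hdvbar : is_conormal Omega (fun x => (gamma0 x)%:M)
  (fun i x => conjc (gradv i x)) (fun x => tau%:C%C * conjc (v x)) dvbar.
Hypothesis hg : forall h, g h = Psi * dv h.
Hypothesis hwbd : is_conormal Omega gamma gradw
  (fun x => tau%:C%C * w x + q * F x) g.
Hypothesis htrvbar : is_trace Omega (fun x => conjc (v x))
  (fun i x => conjc (gradv i x)) trvbar.
Hypothesis htrw : is_trace Omega w gradw trw.

(** Scaling by [Psi] makes [g] the conormal derivative of [u]; [q] will be [expR (- tau * T)]. *)
Let u x := Psi * v x.
Let Gu i x := Psi * gradv i x.
Let F' x := q * F x.

Let L2v : inL2 leb Omega v. Proof. by case: hv. Qed.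
Let L2w : inL2 leb Omega w. Proof. by case: hw. Qed.
Let L2gv i : inL2 leb Omega (gradv i). Proof. by case: hv. Qed.
Let L2gw i : inL2 leb Omega (gradw i). Proof. by case: hw. Qed.
Let L2u : inL2 leb Omega u. Proof. exact: inL2Z. Qed.
Let L2F' : inL2 leb Omega F'. Proof. exact: inL2Z. Qed.
Let L2Gu i : inL2 leb Omega (Gu i). Proof. exact: inL2Z. Qed.

Let cdotZl (M : 'M[R]_n) c (a b : 'I_n -> R[i]) :
  c * cdot M a b = cdot M (fun i => c * a i) b.
Proof.
rewrite /cdot mulr_sumr; apply: eq_bigr => i _; rewrite mulr_sumr.
by apply: eq_bigr => j _; ring.
Qed.

Let cdotZr (M : 'M[R]_n) c (a b : 'I_n -> R[i]) :
  c * cdot M a b = cdot M a (fun i => c * b i).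
Proof.
rewrite /cdot mulr_sumr; apply: eq_bigr => i _; rewrite mulr_sumr.
by apply: eq_bigr => j _; ring.
Qed.

Let sm i j : measurable_fun Omega (fun x => ((gamma0 x)%:M : 'M[R]_n) i j).
Proof. exact: scalar_mx_meas. Qed.
Let sb i j : {ae leb, forall x, Omega x -> `|((gamma0 x)%:M : 'M[R]_n) i j| <= L0}.
Proof. exact: scalar_mx_bound. Qed.
Let L2cgv i : inL2 leb Omega (fun x => conjc (gradv i x)).
Proof. exact: inL2_conj. Qed.
Let L2cgw i : inL2 leb Omega (fun x => conjc (gradw i x)).
Proof. exact: inL2_conj. Qed.
Let L2tw : inL2 leb Omega (fun x => tau%:C%C * w x + F' x).
Proof. by apply: inL2D => //; exact: inL2Z. Qed.

Let cuE x : conjc (u x) = conjc Psi * conjc (v x).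
Proof. exact: rmorphM. Qed.
Let cGuE x : (fun i => conjc (Gu i x)) = (fun i => conjc Psi * conjc (gradv i x)).
Proof. by apply: funext => i; exact: rmorphM. Qed.

Let f1 x := cdot (gamma x) (gradw^~ x) (fun i => conjc (Gu i x))
  + (tau%:C%C * w x + F' x) * conjc (u x).
Let f2 x := cdot (gamma0 x)%:M (Gu^~ x) (fun i => conjc (Gu i x))
  + tau%:C%C * u x * conjc (u x).
Let f3 x := cdot (gamma x) (gradw^~ x) (fun i => conjc (gradw i x))
  + (tau%:C%C * w x + F' x) * conjc (w x).
Let f4 x := cdot (gamma0 x)%:M (Gu^~ x) (fun i => conjc (gradw i x))
  + tau%:C%C * u x * conjc (w x).
Let f5 x := cdot (gamma0 x)%:M (fun i => conjc (Gu i x)) (gradw^~ x)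
  + tau%:C%C * conjc (u x) * w x.

(** Green's formula is tested with conj v, whose trace is given; the factor conj Psi is put back
    afterwards. *)
Let int_f1 : cintegral leb Omega f1 = conjc Psi * g trvbar.
Proof.
rewrite (hwbd.2 _ _ _ (inH1_conj hv) htrvbar) -cintegralZ//.
  by apply: eq_cintegral => x _; rewrite /f1 cGuE cuE -cdotZr -/(F' x) /flux_dot -/(cdot _ _ _); ring.
exact: (cintegrable_green mO gamma_meas gamma_bound L2gw L2cgv L2tw (inL2_conj L2v)).
Qed.

Let int_f2 : cintegral leb Omega f2 = conjc Psi * g trvbar.
Proof.
rewrite hg (hdv.2 _ _ _ (inH1_conj hv) htrvbar) mulrA -cintegralZ//.
  by apply: eq_cintegral => x _; rewrite /f2 cGuE cuE -cdotZr -cdotZl /u /flux_dot -/(cdot _ _ _); ring.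
exact: (cintegrable_green mO sm sb L2gv L2cgv (inL2Z mO _ L2v) (inL2_conj L2v)).
Qed.

Let int_f3 : cintegral leb Omega f3 = g (fun x => conjc (trw x)).
Proof. by rewrite (hwbd.2 _ _ _ (inH1_conj hw) (is_trace_conj htrw)). Qed.

Let int_f4 : cintegral leb Omega f4 = g (fun x => conjc (trw x)).
Proof.
rewrite hg (hdv.2 _ _ _ (inH1_conj hw) (is_trace_conj htrw)) -cintegralZ//.
  by apply: eq_cintegral => x _; rewrite /f4 -cdotZl /u /flux_dot -/(cdot _ _ _); ring.
exact: (cintegrable_green mO sm sb L2gv L2cgw (inL2Z mO _ L2v) (inL2_conj L2w)).
Qed.

Let int_f5 : cintegral leb Omega f5 = conjc Psi * dvbar trw.
Proof.
rewrite (hdvbar.2 _ _ _ hw htrw) -cintegralZ//.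
  by apply: eq_cintegral => x _; rewrite /f5 cGuE cuE -cdotZl /flux_dot -/(cdot _ _ _); ring.
exact: (cintegrable_green mO sm sb L2cgv L2gw (inL2Z mO _ (inL2_conj L2v)) L2w).
Qed.

Let JE : normc (cintegral leb Omega f1 - cintegral leb Omega f5) =
  normc Psi * normc (g trvbar - dvbar trw).
Proof. by rewrite int_f1 int_f5 -mulrBr normcM normc_conj. Qed.

Let XE : grad_energy leb D Gu = (normc Psi * gradnorm D gradv) ^+ 2.
Proof.
rewrite exprMn sqr_gradnorm mulr_sumr; apply: eq_bigr => i _.
rewrite L2normZ//; have [mg _] := L2gv i; apply: integrable_inL2.
  by split; apply: measurable_funS (mg.1) || apply: measurable_funS (mg.2).
by apply: integrableS (inL2_integrable (L2gv i)).
Qed.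

Let err s := (1 + s) * (normc q * L2norm leb Omega F) ^+ 2
  + (normc Psi * H1norm Omega v gradv) ^+ 2 / s.

(** [1 <= tau] replaces [tau^-1] by 1, and the L^2 norm of v is enlarged to its H^1 norm, whose
    growth is known. *)
Let err_le s : 1 <= tau -> 0 < s ->
  (tau^-1 + s) * L2norm leb Omega F' ^+ 2 + L2norm leb Omega u ^+ 2 / s <= err s.
Proof.
move=> tau1 s0.
have -> : L2norm leb Omega F' ^+ 2 = (normc q * L2norm leb Omega F) ^+ 2.
  by rewrite exprMn; exact: L2normZ.
have -> : L2norm leb Omega u ^+ 2 = (normc Psi * L2norm leb Omega v) ^+ 2.
  by rewrite exprMn; exact: L2normZ.
apply: lerD.
  by apply: ler_wpM2r; [exact: sqr_ge0|rewrite lerD2r invf_le1].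
apply: ler_wpM2r; first by rewrite invr_ge0 ltW.
have P0 := normc_ge0 Psi.
rewrite lerXn2r ?nnegrE ?mulr_ge0 ?sqrtr_ge0//.
by rewrite ler_wpM2l// L2norm_le_H1norm.
Qed.

Lemma indicator_ge s : 1 <= tau -> 0 < s ->
  Num.min m C' / 2 * (normc Psi * gradnorm D gradv) ^+ 2 - err s <=
  normc Psi * normc (g trvbar - dvbar trw).
Proof.
move=> tau1 s0; rewrite -JE -XE.
apply: le_trans (indicator_lower mO mD DO C_gt0 m_gt0 C'_gt0 gamma_meas gamma_bound
  gamma0_meas gamma0_bound gamma_adm gamma_jump tau_gt0 s0 L2u L2w L2F' L2Gu L2gw
  (etrans int_f1 (esym int_f2)) (etrans int_f3 (esym int_f4))).
by rewrite lerD2l lerN2 err_le.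
Qed.

Lemma indicator_le s : 1 <= tau -> 0 < s ->
  normc Psi * normc (g trvbar - dvbar trw) <=
  upper_const n L C * (normc Psi * gradnorm D gradv) ^+ 2 + upper_const n L C * err s.
Proof.
move=> tau1 s0; rewrite -JE -XE.
apply: le_trans (indicator_upper mO mD DO C_gt0 L_ge0 gamma_meas gamma_bound
  gamma0_meas gamma0_bound gamma_adm tau_gt0 s0 L2u L2w L2F' L2Gu L2gw
  (etrans int_f1 (esym int_f2)) (etrans int_f3 (esym int_f4))) _.
rewrite lerD2l ler_wpM2l ?err_le// (le_trans (ler0n R 2))//.
exact: upper_const_ge2.
Qed.

End indicator.

Unset Implicit Arguments.

Theorem theorem1p1 (R : realType) (n : nat) (hn : n = 2%N \/ n = 3%N)
  (Omega D : set 'rV[R]_n) (hOmega : bounded_smooth_domain Omega)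
  (T : R) (hT : 0 < T)
  (gamma : 'rV[R]_n -> 'M[R]_n) (gamma0 : 'rV[R]_n -> R)
  (hstand : standing_assumptions Omega D gamma gamma0)
  (tau0 : R) (htau0 : 0 < tau0)
  (C1 mu1 : R) (F : R -> 'rV[R]_n -> R[i])
  (hF : forall tau, tau0 <= tau -> inL2 (lebesgue_rV R n) Omega (F tau))
  (hFO : bigO_pinfty (fun tau => L2norm (lebesgue_rV R n) Omega (F tau))
     (fun tau => expR (C1 * tau) * tau `^ mu1))
  (v : R -> 'rV[R]_n -> R[i]) (gradv : R -> 'I_n -> 'rV[R]_n -> R[i])
  (hv : forall tau, tau0 <= tau -> inH1 Omega (v tau) (gradv tau))
  (hveq : forall tau, tau0 <= tau ->
     weak_div Omega (fun x => (gamma0 x)%:M) (gradv tau)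
       (fun x => tau%:C%C * v tau x))
  (mu2 mu3 mu4 C2 C3 C'' : R) (hC'' : 0 < C'')
  (hvD : bigO_pinfty (fun tau => gradnorm D (gradv tau))
     (fun tau => expR (C2 * tau) * tau `^ mu2))
  (hvDlow : \forall tau \near +oo_R,
     gradnorm D (gradv tau) >= C'' * expR (C2 * tau) * tau `^ mu3)
  (hvH1 : bigO_pinfty (fun tau => H1norm Omega (v tau) (gradv tau))
     (fun tau => expR (C3 * tau) * tau `^ mu4))
  (Psi : R -> R[i]) (mu mu' : R)
  (hPsilow : (0 < limf_einf
     (fun tau : R => (tau `^ mu * normc (Psi tau))%:E) +oo_R)%E)
  (hPsi : bigO_pinfty (fun tau => normc (Psi tau))
     (fun tau => tau `^ mu'))
  (* dv tau = gamma0 d(v_tau)/dnu,  dvbar tau = gamma0 d(conj v_tau)/dnu *)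
  (dv dvbar g : R -> ('rV[R]_n -> R[i]) -> R[i])
  (hdv : forall tau, tau0 <= tau ->
     is_conormal Omega (fun x => (gamma0 x)%:M) (gradv tau)
       (fun x => tau%:C%C * v tau x) (dv tau))
  (hdvbar : forall tau, tau0 <= tau ->
     is_conormal Omega (fun x => (gamma0 x)%:M)
       (fun i x => conjc (gradv tau i x))
       (fun x => tau%:C%C * conjc (v tau x)) (dvbar tau))
  (hg : forall tau, tau0 <= tau -> forall h, g tau h = Psi tau * dv tau h)
  (w : R -> 'rV[R]_n -> R[i]) (gradw : R -> 'I_n -> 'rV[R]_n -> R[i])
  (hw : forall tau, tau0 <= tau -> inH1 Omega (w tau) (gradw tau))
  (hweq : forall tau, tau0 <= tau ->
     weak_div Omega gamma (gradw tau)
       (fun x => tau%:C%C * w tau x + (expR (- tau * T))%:C%C * F tau x))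
  (hwbd : forall tau, tau0 <= tau ->
     is_conormal Omega gamma (gradw tau)
       (fun x => tau%:C%C * w tau x + (expR (- tau * T))%:C%C * F tau x)
       (g tau))
  (* boundary traces of conj v_tau and of w *)
  (trvbar trw : R -> 'rV[R]_n -> R[i])
  (htrvbar : forall tau, tau0 <= tau ->
     is_trace Omega (fun x => conjc (v tau x))
       (fun i x => conjc (gradv tau i x)) (trvbar tau))
  (htrw : forall tau, tau0 <= tau ->
     is_trace Omega (w tau) (gradw tau) (trw tau))
  (hTlarge : C1 + C3 - 2 * C2 < T) :
  (((2 * tau)^-1)%R%:E *
     lne (normc (g tau (trvbar tau) - dvbar tau (trw tau)))%R%:E)%E
    @[tau --> +oo_R] --> C2%:E.
Proof.
have [L [L0 [C [m [C' [C0 m0 C'0 L_ge0 [gb g0b adm jmp]]]]]]] := standing_bounds hOmega hstand.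
have mO : measurable Omega by apply: open_rV_measurable; exact: domain_open hOmega.
have mD : measurable D by apply: open_rV_measurable; exact: D_open hstand.
have DO := inclusion_sub hstand.
have gm i j : measurable_fun Omega (fun x => gamma x i j).
  by have [] := gamma_Linfty hstand i j.
have g0m := gamma0_measurable hstand.
have ntau : \forall tau \near +oo_R, tau0 <= tau /\ 1 <= tau.
  by near=> tau; split; near: tau; apply: nbhs_pinfty_ge; rewrite num_real.
pose K := upper_const n L C.
have K2 : 2 <= K by exact: upper_const_ge2.
apply: (@cvg_indicator_rate _ T C1 mu1 mu2 mu3 mu4 C2 C3 C'' mu mu'
  (Num.min m C' / 2) K (fun tau => gradnorm D (gradv tau))
  (fun tau => H1norm Omega (v tau) (gradv tau))
  (fun tau => L2norm (lebesgue_rV R n) Omega (F tau)) (fun tau => normc (Psi tau))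
  (fun tau => normc (g tau (trvbar tau) - dvbar tau (trw tau)))) => //.
- by rewrite divr_gt0// lt_min m0 C'0.
- by apply: lt_le_trans K2.
- by move=> t; exact: sqrtr_ge0.
- by move=> t; exact: sqrtr_ge0.
- by move=> t; exact: sqrtr_ge0.
- by move=> t; exact: normc_ge0.
- apply: filterS ntau => t [t0 _]; have [_ Lg _] := hv t t0.
  exact: gradnorm_le_H1norm.
- apply: filterS ntau => t [t0 t1] s s0.
  have tp : 0 < t by exact: lt_le_trans t1.
  have nq : normc (expR (- t * T))%:C%C = expR (- t * T).
    by rewrite /= expr0n/= addr0 sqrtr_sqr ger0_norm// expR_ge0.
  have := indicator_ge mO mD DO C0 m0 C'0 gm gb g0m g0b adm jmp tp (hF t t0)
    (hv t t0) (hw t t0) (hdv t t0) (hdvbar t t0) (hg t t0) (hwbd t t0)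
    (htrvbar t t0) (htrw t t0) t1 s0.
  (* [indicator_ge] has the error with coefficient 1, while [cvg_indicator_rate] uses one constant
     [K] in both bounds; [K >= 2] and a nonnegative error suffice. *)
  rewrite nq; apply: le_trans; rewrite lerD2l lerN2 ler_peMl//; last by lra.
  have [s1 s2] : 0 <= 1 + s /\ 0 <= s^-1 by rewrite invr_ge0; lra.
  exact: addr_ge0 (mulr_ge0 s1 (sqr_ge0 _)) (mulr_ge0 (sqr_ge0 _) s2).
- apply: filterS ntau => t [t0 t1] s s0.
  have tp : 0 < t by exact: lt_le_trans t1.
  have nq : normc (expR (- t * T))%:C%C = expR (- t * T).
    by rewrite /= expr0n/= addr0 sqrtr_sqr ger0_norm// expR_ge0.
  have := indicator_le mO mD DO C0 L_ge0 gm gb g0m g0b adm tp (hF t t0)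
    (hv t t0) (hw t t0) (hdv t t0) (hdvbar t t0) (hg t t0) (hwbd t t0)
    (htrvbar t t0) (htrw t t0) t1 s0.
  by rewrite nq.
Unshelve. all: by end_near. Qed.
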